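(* Let $0 < \beta < \infty$. Let $X, X_1, X_2, \ldots$ be independent identically distributed real-valued random variables and $S_n = X_1 + \cdots + X_n$, $n \ge 1$. Then $$\limsup_{n \rightarrow \infty} \left| \frac{S_{n}}{\sqrt{n}} \right|^{(\log \log n)^{-1}} = e^{\beta} \quad \text{almost surely}$$ if and only if $$\mathbb{E}X = 0 \quad\text{and}\quad \inf \left\{b > 0:~ \mathbb{E} \left(\frac{X^{2}}{(L|X|)^{2b}} \right) < \infty \right\} = \beta.$$
   Context: $\log$ is the natural logarithm and $Lx = \log(\max(e, x))$ for $x \ge 0$. The quantity $|\cdot|^{(\log\log n)^{-1}}$ is considered for $n \ge 3$. The infimum of the empty set is $+\infty$. The condition $\mathbb{E}X = 0$ includes that $\mathbb{E}X$ exists. *)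

(* Defs.v *)
From HB Require Import structures.
From mathcomp Require Import all_boot all_order all_algebra finmap.
From mathcomp Require Import all_classical all_reals all_analysis.

Set Implicit Arguments.
Unset Strict Implicit.
Unset Printing Implicit Defensive.

Import Order.TTheory GRing.Theory Num.Theory.
Import numFieldNormedType.Exports.

Local Open Scope classical_set_scope.
Local Open Scope ring_scope.

Definition mutually_independent (d : measure_display) (T : measurableType d)
    (R : realType) (P : probability T R) (I : choiceType)
    (X : I -> {RV P >-> R}) : Prop :=
  forall (J : {fset I}) (B : I -> set R),
    (forall i, i \in J -> measurable (B i)) ->
    P (\bigcap_(i in [set` J]) X i @^-1` B i) =
    (\prod_(i <- J) P (X i @^-1` B i))%E.

(* The laws are compared on measurable sets only: [P], hence [distribution P],
   is an unconstrained set function elsewhere. *)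
Definition identically_distributed (d : measure_display) (T : measurableType d)
    (R : realType) (P : probability T R) (I : Type)
    (X : I -> {RV P >-> R}) : Prop :=
  forall (i j : I) (B : set R), measurable B ->
    distribution P (X i) B = distribution P (X j) B.

Definition iid (d : measure_display) (T : measurableType d)
    (R : realType) (P : probability T R) (I : choiceType)
    (X : I -> {RV P >-> R}) : Prop :=
  mutually_independent X /\ identically_distributed X.

Definition logplus (R : realType) (x : R) : R := ln (Num.max (expR 1) x).

(* A family [X] indexed by [nat] encodes X, X_1, X_2, ...: [X 0] is the generic
   copy X, and is not a summand. *)
Definition partial_sum (d : measure_display) (T : measurableType d)
    (R : realType) (P : probability T R) (X : nat -> {RV P >-> R})
    (n : nat) (w : T) : R :=
  \sum_(1 <= i < n.+1) X i w.

(* |S_n / sqrt n| ^ (1 / log log n), meaningful for n >= 3; the junk values at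
   n < 3 do not affect the limit superior. *)
Definition normalized_sum (d : measure_display) (T : measurableType d)
    (R : realType) (P : probability T R) (X : nat -> {RV P >-> R})
    (n : nat) (w : T) : R :=
  `|partial_sum X n w / Num.sqrt n%:R| `^ (ln (ln n%:R))^-1.

(* The infimum is taken in the extended reals, where it is +oo on the empty
   set. *)
Definition moment_index (d : measure_display) (T : measurableType d)
    (R : realType) (P : probability T R) (Y : {RV P >-> R}) : \bar R :=
  ereal_inf [set b%:E | b in [set b : R | 0 < b /\
    ('E_P[fun w => ((Y w) ^+ 2 / (logplus `|Y w|) `^ (2 * b))%R] < +oo)%E]].

(* Main.v *)
Require Import Defs.
From HB Require Import structures.
From mathcomp Require Import all_boot all_order all_algebra finmap.
From mathcomp Require Import all_classical all_reals all_analysis.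
From mathcomp Require Import measurable_realfun ring lra.

(** Taking logarithms, the limit superior equals [expR beta] if and only if, with
    [growth b n = sqrt n * (L n) ^ b], almost surely the partial sums satisfy
    [`|S n| <= growth b n] eventually for every [b > beta] and
    [`|S n| > growth b n] infinitely often for every [b < beta].  Each of the two
    conditions is governed by the finiteness of the moment
    [E (X ^ 2 / (L `|X|) ^ (2 * b))], because the exponent can always be changed a
    little: constants are absorbed by small powers of [L n].

    Infinite moment.  The function [x ^ 2 / (L x) ^ (2 * b)] is of order [n] at
    [x = growth b n], so an infinite moment means that the tails
    [P (`|X| > 2 * growth b n)] are not summable ([moment_lty_of_tails]).  By the
    second Borel-Cantelli lemma ([borel_cantelli_indep]) summands beyond
    [2 * growth b n] occur infinitely often, and such a summand is the difference
    of two partial sums, one of which is beyond [growth b n] ([limsup_ge]).  The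
    same fact, read backwards, shows that a limit superior equal to [expR beta]
    forces the moments of all exponents [b > beta] to be finite
    ([moment_lty_of_limsup]).

    Finite moment.  If the moment of exponent [b] is finite and [b < b'], then
    almost surely [S n - n * E X = O(growth b' n)] ([deviation_bound]).  When
    [E X = 0] this bounds the limit superior by [expR b'].  When instead the limit
    superior is known to be finite, [S n] and [S n - n * E X] are both [o(n)], which
    leaves no room for a nonzero mean.

    For [deviation_bound], consider a block of times up to [2 ^ k.+1] and truncate
    the summands at [2 ^ (k / 2) * (k + 1) ^ b].  By the moment condition, the
    probabilities that some summand of the block exceeds this level are summable in
    [k].  The truncated variables divided by the level have variances that add up
    to [O(1)] over the block, so the exponential moment of their centred sum is
    bounded uniformly in [k].  An exponential maximal inequality
    ([exponential_maximal_inequality]) bounds the probability that the walk leaves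
    the corridor of width [(k + 1) ^ (b' - b)] levels by a constant times
    [exp (- (k + 1) ^ (b' - b))].  This is summable for every [b' > b], even when
    [b' < 1 / 2], where second moments alone would not suffice.  The maximal
    inequality needs that the past of the walk is independent of the next
    increment, which is derived from the product rule for finitely many
    coordinates by a pi-lambda argument ([past_indep]). *)

Import Order.TTheory GRing.Theory Num.Theory.
Import numFieldNormedType.Exports.

Local Open Scope classical_set_scope.
Local Open Scope ring_scope.

(** * Logarithmic weights and growth rates *)

Definition moment_weight {R : realType} (b x : R) : R :=
  x ^+ 2 / logplus `|x| `^ (2 * b).

Definition growth {R : realType} (b : R) (n : nat) : R :=
  Num.sqrt n%:R * logplus n%:R `^ b.

(** The level at which the summands with index at most [2 ^ k.+1] are truncated.
    It is [growth b (2 ^ k)] with [k.+1] for the logarithm, so that it is at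
    least 1 even for [k = 0]. *)
Definition trunc_level {R : realType} (b : R) (k : nat) : R :=
  Num.sqrt (2 ^+ k) * k.+1%:R `^ b.

Section calculus.
Context {R : realType}.
Implicit Types a b c e x y : R.

(** The only growth comparison behind all the estimates: a Taylor monomial of
    the exponential dominates the power. *)
Lemma powR_le_expR a e : 0 <= a -> 0 < e ->
  exists2 K, 0 < K & forall x, 0 <= x -> x `^ a <= K * expR (e * x).
Proof.
move=> a0 e0; pose n := (Num.truncn a).+1.
have an : a <= n%:R by exact/ltW/truncnS_gt.
have n1 : 1 <= n`!%:R :> R by rewrite ler1n fact_gt0.
have key y : 0 <= y -> y `^ a <= n`!%:R * expR y.
  move=> y0; have [y1|y1] := leP 1 y.
    apply: (le_trans (ler_powR y1 an)); rewrite powR_mulrn//.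
    rewrite mulrC -ler_pdivrMr ?(lt_le_trans _ n1)//.
    by apply: le_trans (expR_ge1Dxn n.-1 y0); rewrite lerDr.
  have : y `^ a <= 1 `^ a by apply: ge0_ler_powR; rewrite ?nnegrE// ltW.
  rewrite powR1 => /le_trans; apply; rewrite -[leLHS]mul1r ler_pM//.
  by rewrite -expR0 ler_expR.
exists (n`!%:R / e `^ a) => [|x x0].
  by rewrite divr_gt0 ?powR_gt0// (lt_le_trans _ n1).
have := key (e * x) (mulr_ge0 (ltW e0) x0).
by rewrite powRM ?(ltW e0)// mulrAC ler_pdivlMr ?powR_gt0// mulrC.
Qed.

Lemma logplus_ge1 x : 1 <= logplus x.
Proof.
by rewrite /logplus -[leLHS](@expRK R) ler_ln ?posrE ?expR_gt0 ?lt_max ?le_max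
  ?lexx ?expR_gt0.
Qed.

Lemma logplus_gt0 x : 0 < logplus x.
Proof. exact: lt_le_trans ltr01 (logplus_ge1 x). Qed.

Lemma logplus_le x y : x <= y -> logplus x <= logplus y.
Proof.
move=> xy; rewrite /logplus ler_ln ?posrE ?lt_max ?expR_gt0//.
by rewrite ge_max le_max lexx/= le_max xy orbT.
Qed.

Lemma ln_le_logplus x : 0 < x -> ln x <= logplus x.
Proof.
by move=> x0; rewrite /logplus ler_ln ?posrE ?lt_max ?expR_gt0// le_max lexx orbT.
Qed.

Lemma logplus_le_of_expR x y : 1 <= y -> x <= expR y -> logplus x <= y.
Proof.
move=> y1 xy; rewrite -[leRHS](@expRK R) /logplus.
by rewrite ler_ln ?posrE ?lt_max ?expR_gt0// ge_max xy ler_expR y1.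
Qed.

Lemma logplus_ln x : expR 1 <= x -> logplus x = ln x.
Proof. by move=> x1; rewrite /logplus max_r. Qed.

Lemma powR_logplus_ge1 x b : 0 <= b -> 1 <= logplus x `^ b.
Proof.
by move=> b0; rewrite -[leLHS](@powRr0 R (logplus x)) ler_powR ?logplus_ge1.
Qed.

(** [powR_le_expR] at [logplus x] with rate [1 / 2], as [expR (logplus x / 2)] is
    of order [sqrt x]. *)
Lemma powR_logplus_le_sqrt a : 0 <= a ->
  exists2 K, 1 <= K & forall x, 1 <= x -> logplus x `^ a <= K * Num.sqrt x.
Proof.
move=> a0; have [K K0 HK] := @powR_le_expR a 2^-1 a0 ltac:(by rewrite invr_gt0).
exists (Num.max 1 (K * Num.sqrt (expR 1))); first by rewrite le_max lexx.
move=> x x1; apply: (le_trans (HK _ (ltW (logplus_gt0 x)))).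
rewrite [2^-1 * _]mulrC expRM powR12_sqrt ?expR_ge0// /logplus lnK; last first.
  by rewrite posrE lt_max expR_gt0.
apply: (@le_trans _ _ (K * Num.sqrt (expR 1) * Num.sqrt x)); last first.
  by rewrite ler_wpM2r ?sqrtr_ge0// le_max lexx orbT.
rewrite -mulrA ler_wpM2l ?(ltW K0)// -sqrtrM ?expR_ge0// ler_wsqrtr//.
rewrite ge_max ler_peMr ?expR_ge0//= ler_peMl ?(le_trans _ x1)//.
by rewrite -expR0 ler_expR.
Qed.

Lemma moment_weight_ge0 b x : 0 <= moment_weight b x.
Proof. by rewrite /moment_weight divr_ge0 ?sqr_ge0 ?powR_ge0. Qed.

Lemma moment_weight_norm b x : moment_weight b `|x| = moment_weight b x.
Proof. by rewrite /moment_weight normr_id real_normK ?num_real. Qed.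

Lemma trunc_level_ge1 b k : 0 <= b -> 1 <= trunc_level b k.
Proof.
move=> b0; rewrite /trunc_level -[leLHS]mulr1 ler_pM//.
  by rewrite -[leLHS]sqrtr1 ler_wsqrtr// exprn_ege1 ?ler1n.
by rewrite -[leLHS](@powRr0 R k.+1%:R) ler_powR// ler1n.
Qed.

Lemma ln2_gt0 : 0 < ln 2 :> R.
Proof. by rewrite ln_gt0// ltr1n. Qed.

Lemma sqrt2X_ge1 k : 1 <= Num.sqrt (2 ^+ k) :> R.
Proof. by rewrite -[leLHS]sqrtr1 ler_wsqrtr// exprn_ege1 ?ler1n. Qed.

Lemma powR_sqr x b : 0 <= x -> x `^ (2 * b) = x `^ b ^+ 2.
Proof.
by move=> x0; rewrite mulrC powRrM -powR_mulrn ?powR_ge0.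
Qed.

(** What truncation discards is paid for by the moment.  The weight need not be
    monotone, so the cases [x <= 2 ^ k] and [2 ^ k < x] are treated apart: in the
    first [logplus x] is at most [k.+1], in the second powers of [logplus x] are
    absorbed by [sqrt x].  The first bound gives the summability of the tails
    along dyadic blocks, the second one the error made on the mean. *)
Lemma above_trunc_level b : 0 <= b -> exists2 K, 1 <= K &
  forall k x, trunc_level b k < x ->
    2 ^+ k <= K * moment_weight b x /\
    x <= K * (k.+1%:R `^ b / Num.sqrt (2 ^+ k)) * moment_weight b x.
Proof.
move=> b0.
have [K K1 HK] := @powR_logplus_le_sqrt (2 * b) (mulr_ge0 (ler0n _ 2) b0).
have K0 : 0 < K by exact: lt_le_trans K1.
exists K => // k x cx; set s := Num.sqrt _.
have s1 : 1 <= s := sqrt2X_ge1 k.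
have s0 : 0 < s by exact: lt_le_trans s1.
have sE : 2 ^+ k = s ^+ 2 :> R by rewrite /s sqr_sqrtr// exprn_ge0.
set p := k.+1%:R `^ b.
have p1 : 1 <= p by rewrite -[leLHS](@powRr0 R k.+1%:R) ler_powR// ler1n.
have p0 : 0 < p by exact: lt_le_trans p1.
have x1 : 1 < x by apply: le_lt_trans cx; exact: trunc_level_ge1.
have x0 : 0 < x by exact: lt_trans x1.
have spx : s * p < x by [].
suff main : x * s / (K * p) <= moment_weight b x.
  have M0 := moment_weight_ge0 b x.
  have ineq : x * s <= K * p * moment_weight b x.
    by rewrite [leRHS]mulrC -ler_pdivrMr ?mulr_gt0.
  split; last first.
    rewrite (_ : K * (p / s) * _ = K * p * moment_weight b x / s); last by ring.
    by rewrite ler_pdivlMr.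
  rewrite sE -(ler_pM2r p0) (_ : K * _ * p = K * p * moment_weight b x); last by ring.
  apply: (le_trans _ ineq); rewrite (_ : s ^+ 2 * p = (s * p) * s); last by ring.
  by rewrite ler_wpM2r ?ltW.
have [xk|xk] := leP x (2 ^+ k).
  have Lx : logplus x <= k.+1%:R.
    apply: logplus_le_of_expR; first by rewrite ler1n.
    apply: (le_trans xk); rewrite -[k.+1%:R]mulr1 expRM_natl.
    have e2 : 2 <= expR 1 :> R by apply: le_trans (expR_ge1Dx 1).
    apply: (@le_trans _ _ (expR 1 ^+ k)); first by rewrite lerXn2r ?nnegrE ?expR_ge0.
    by rewrite ler_eXn2l// (lt_le_trans _ e2)// ltr1n.
  rewrite /moment_weight (ger0_norm (ltW x0)) powR_sqr ?(ltW (logplus_gt0 _))//.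
  have q0 : 0 < logplus x `^ b by rewrite powR_gt0 ?logplus_gt0.
  have Lp : logplus x `^ b <= p.
    by apply: ge0_ler_powR => //; rewrite nnegrE ?(ltW (logplus_gt0 _)).
  apply: (@le_trans _ _ (x ^+ 2 / p ^+ 2)); last first.
    rewrite ler_wpM2l ?sqr_ge0// lef_pV2 ?posrE ?exprn_gt0//.
    by rewrite lerXn2r ?nnegrE ?(ltW q0) ?(ltW p0).
  rewrite ler_pdivrMr ?mulr_gt0// mulrAC ler_pdivlMr ?exprn_gt0//.
  rewrite !expr2 (_ : x * s * (p * p) = (x * p) * (s * p)); last by ring.
  rewrite (_ : x * x * (K * p) = (x * p) * (K * x)); last by ring.
  by rewrite ler_pM2l ?mulr_gt0// (le_trans (ltW spx))// ler_peMl ?(ltW x0).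
rewrite /moment_weight (ger0_norm (ltW x0)).
have sx : s <= Num.sqrt x by rewrite ler_wsqrtr// ltW.
have xE : x = Num.sqrt x ^+ 2 by rewrite sqr_sqrtr// ltW.
have q0 : 0 < logplus x `^ (2 * b) by rewrite powR_gt0 ?logplus_gt0.
apply: (@le_trans _ _ (x ^+ 2 / (K * Num.sqrt x))); last first.
  rewrite ler_wpM2l ?sqr_ge0// lef_pV2 ?posrE ?mulr_gt0 ?sqrtr_gt0//.
  by rewrite HK// ltW.
rewrite {2}xE; set t := Num.sqrt x in sx xE *.
have t0 : 0 < t by rewrite sqrtr_gt0.
have -> : (t ^+ 2) ^+ 2 / (K * t) = t ^+ 2 * t / K by field; rewrite !gt_eqF.
rewrite -xE ler_pdivrMr ?mulr_gt0//.
have -> : x * t / K * (K * p) = x * (t * p) by field; rewrite gt_eqF.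
by rewrite ler_pM2l// (le_trans sx)// ler_peMr ?(ltW t0).
Qed.

(** What truncation keeps has a second moment of order [k.+1 `^ (2 * b)],
    because the logarithm of the level is linear in [k]. *)
Lemma below_trunc_level b k x : 0 <= b -> `|x| <= trunc_level b k ->
  x ^+ 2 <= ((1 + b) * k.+1%:R) `^ (2 * b) * moment_weight b x.
Proof.
move=> b0 xc; have q0 : 0 < logplus `|x| `^ (2 * b).
  by rewrite powR_gt0 ?logplus_gt0.
have c1 := @trunc_level_ge1 b k b0.
rewrite /moment_weight mulrA ler_pdivlMr// mulrC ler_wpM2r ?sqr_ge0//.
have bk : 1 <= (1 + b) * k.+1%:R by rewrite -[leLHS]mulr1 ler_pM ?ler1n ?lerDl.
apply: ge0_ler_powR; rewrite ?mulr_ge0 ?nnegrE ?(ltW (logplus_gt0 _))//.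
  exact: le_trans bk.
apply: logplus_le_of_expR => //; apply: (le_trans xc).
rewrite /trunc_level -{1}(@lnK _ k.+1%:R) ?posrE// -expRM.
rewrite mulrDl mul1r expRD ler_pM ?sqrtr_ge0 ?expR_ge0//; last first.
  by rewrite ler_expR mulrC ler_wpM2l// ltW// ln_sublinear.
have e2 : 2 <= expR 1 :> R by apply: le_trans (expR_ge1Dx 1).
have e1 : 1 <= expR 1 :> R by apply: le_trans e2; rewrite ler1n.
apply: (@le_trans _ _ (2 ^+ k)).
  have := sqrt2X_ge1 k; set s := Num.sqrt _ => s1.
  rewrite -[leRHS]sqr_sqrtr ?exprn_ge0// -/s expr2 ler_peMl//.
  exact: le_trans s1.
rewrite -[k.+1%:R]mulr1 expRM_natl (@le_trans _ _ (expR 1 ^+ k))//.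
  by rewrite lerXn2r ?nnegrE ?expR_ge0.
by rewrite ler_weXn2l.
Qed.

Lemma norm_le_moment_weight b : 0 <= b -> exists2 K, 0 <= K &
  forall x, `|x| <= 1 + K * moment_weight b x.
Proof.
move=> b0; have [K K1 HK] := above_trunc_level b b0.
exists K => [|x]; first exact: le_trans K1.
have M0 := moment_weight_ge0 b x.
have [x1|x1] := leP `|x| 1.
  by rewrite (le_trans x1)// lerDl mulr_ge0// (le_trans _ K1).
have /(HK 0)[_] : trunc_level b 0 < `|x|.
  by rewrite /trunc_level expr0 sqrtr1 powR1 mulr1.
rewrite expr0 sqrtr1 powR1 divr1 mulr1 moment_weight_norm => /le_trans; apply.
by rewrite lerDr.
Qed.

(** Read contrapositively, a large weight forces [x] above [C * growth b n]; this
    turns convergent tail sums into moments.  The weight need not be monotone: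
    for [x ^ 4 < n] it is bounded by [x ^ 2], and for larger [x] the
    logarithms of [x] and of [n] are comparable. *)
Lemma moment_weight_le_linear b C : 0 < b -> 0 < C -> exists2 K, 0 < K &
  forall n x, `|x| <= C * growth b n -> moment_weight b x <= K * n%:R.
Proof.
move=> b0 C0; have b20 : 0 <= 2 * b by rewrite mulr_ge0 ?ltW.
exists (C ^+ 2 * 4 `^ (2 * b) + 1).
  by rewrite ltr_pwDr// mulr_ge0 ?exprn_ge0 ?powR_ge0 ?ltW.
move=> [|n] x.
  rewrite /growth sqrtr0 mul0r mulr0 normr_le0 => /eqP->.
  by rewrite /moment_weight expr0n/= mul0r mulr0.
move=> xg; rewrite -moment_weight_norm; set y := `|x| in xg *.
have y0 : 0 <= y by rewrite normr_ge0.
have n1 : 1 <= n.+1%:R :> R by rewrite ler1n.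
have [ny|yn] := leP n.+1%:R (y ^+ 4); last first.
  apply: (@le_trans _ _ (y ^+ 2)).
    by rewrite /moment_weight ler_pdivrMr ?powR_gt0 ?logplus_gt0//
      ler_peMr ?sqr_ge0// powR_logplus_ge1.
  apply: (@le_trans _ _ n.+1%:R).
    rewrite -(@ler_pXn2r _ 2) ?nnegrE ?sqr_ge0// -exprM (le_trans (ltW yn))//.
    by rewrite expr2 ler_peMl.
  by rewrite ler_peMl// lerDr mulr_ge0 ?exprn_ge0 ?powR_ge0 ?ltW.
have yp : 0 < y.
  rewrite lt_neqAle y0 andbT eq_sym; apply: contraTneq ny => ->.
  by rewrite expr0n/= -ltNge ltr0n.
have Ln : logplus n.+1%:R <= 4 * logplus y.
  apply: logplus_le_of_expR.
    by rewrite (le_trans (logplus_ge1 y))// ler_peMl ?ler1n// ltW ?logplus_gt0.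
  apply: (le_trans ny); rewrite -{1}(@lnK _ y)// expRM_natl lerXn2r ?nnegrE ?expR_ge0//.
  by rewrite ler_expR ln_le_logplus.
apply: (@le_trans _ _ (C ^+ 2 * 4 `^ (2 * b) * n.+1%:R)); last first.
  by rewrite ler_wpM2r// lerDl.
rewrite /moment_weight ger0_norm// ler_pdivrMr ?powR_gt0 ?logplus_gt0//.
apply: (@le_trans _ _ ((C * growth b n.+1) ^+ 2)).
  by rewrite lerXn2r ?nnegrE ?(le_trans y0).
have L0 (z : R) : 0 <= logplus z by exact/ltW/logplus_gt0.
rewrite /growth !exprMn sqr_sqrtr// -powR_sqr//.
rewrite -(mulrA (C ^+ 2)) -(mulrA (C ^+ 2)) ler_wpM2l ?sqr_ge0//.
rewrite (mulrC (4 `^ _)) -(mulrA n.+1%:R) ler_wpM2l// -powRM//.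
by apply: ge0_ler_powR; rewrite ?nnegrE ?mulr_ge0 ?L0 ?(ltW b0).
Qed.

Lemma trunc_level_le_growth (b : R) : 0 <= b -> exists2 K, 0 <= K &
  forall k n, (2 ^ k <= n)%N -> trunc_level b k <= K * growth b n.
Proof.
move=> b0; pose r := 1 + (ln 2 : R)^-1.
have l0 : 0 < ln 2 :> R := ln2_gt0.
have r0 : 0 <= r by rewrite addr_ge0// invr_ge0 ltW.
exists (r `^ b) => [|k n kn]; first exact: powR_ge0.
have n0 : (0 < n)%N by apply: leq_trans kn; rewrite expn_gt0.
have kn' : 2 ^+ k <= n%:R :> R by rewrite -natrX ler_nat.
have kL1 : k.+1%:R <= r * logplus n%:R.
  have L1 := logplus_ge1 (n%:R : R).
  have kL : k%:R * ln 2 <= logplus n%:R :> R.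
    apply: (@le_trans _ _ (ln n%:R)); last by rewrite ln_le_logplus ?ltr0n.
    by rewrite mulr_natl -lnXn// ler_ln ?posrE ?exprn_gt0 ?ltr0n.
  rewrite -natr1 addrC /r mulrDl mul1r lerD//.
  by rewrite mulrC ler_pdivlMr.
rewrite /trunc_level /growth mulrCA ler_pM ?sqrtr_ge0 ?powR_ge0//.
  exact: ler_wsqrtr.
rewrite -powRM ?(ltW (logplus_gt0 _))//.
apply: ge0_ler_powR; rewrite ?nnegrE ?mulr_ge0 ?(ltW (logplus_gt0 _))//.
Qed.

Lemma exists_nat_gt (x : R) : exists N, forall n, (N <= n)%N -> x < n%:R.
Proof.
exists (Num.truncn x).+1 => n Nn.
by apply: lt_le_trans (truncnS_gt x) _; rewrite ler_nat.
Qed.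

(** A constant factor never matters: it is absorbed by an arbitrarily small
    increase of the exponent. *)
Lemma growth_absorb (C b b' : R) : b < b' ->
  exists N, forall n, (N <= n)%N -> C * growth b n <= growth b' n.
Proof.
move=> bb'; have e0 : 0 < b' - b by rewrite subr_gt0.
pose M := Num.max 1 C; have M0 : 0 < M by rewrite lt_max ltr01.
have [N HN] := exists_nat_gt (expR (M `^ (b' - b)^-1)); exists N => n Nn.
have nL : M `^ (b' - b)^-1 <= logplus n%:R :> R.
  have h := HN n Nn; have n0 : 0 < n%:R :> R by exact: lt_trans (expR_gt0 _) h.
  apply: le_trans (ln_le_logplus _ n0).
  by rewrite -[leLHS](@expRK R) ler_ln ?posrE ?expR_gt0// ltW.
rewrite /growth mulrCA ler_wpM2l ?sqrtr_ge0//.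
have L0 : 0 < logplus n%:R :> R by exact: logplus_gt0.
rewrite -[b' in leRHS](subrK b b') powRD ?(gt_eqF L0) ?implybT//.
rewrite ler_wpM2r ?powR_ge0//.
apply: (@le_trans _ _ M); first by rewrite le_max lexx orbT.
have {1}-> : M = (M `^ (b' - b)^-1) `^ (b' - b).
  by rewrite -powRrM mulVf ?gt_eqF// powRr1// ltW.
by apply: ge0_ler_powR; rewrite ?nnegrE ?powR_ge0 ?(ltW e0) ?(ltW L0).
Qed.

Lemma growth_le (b : R) m n : 0 <= b -> (m <= n)%N -> growth b m <= growth b n.
Proof.
move=> b0 mn; have mn' : m%:R <= n%:R :> R by rewrite ler_nat.
rewrite ler_pM ?sqrtr_ge0 ?powR_ge0 ?ler_wsqrtr//.
by apply: ge0_ler_powR; rewrite ?nnegrE ?(ltW (logplus_gt0 _))// logplus_le.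
Qed.

(** [growth b n] is [o(n)], as its square is at most a multiple of
    [n * sqrt n]; hence a drift [n * m] of that order has [m = 0]. *)
Lemma growth_sublinear (b D m : R) N : 0 <= b ->
  (forall n, (N <= n)%N -> n%:R * `|m| <= D * growth b n) -> m = 0.
Proof.
move=> b0 H; apply/eqP/negPn/negP => m0.
have [K K1 HK] := @powR_logplus_le_sqrt (2 * b) (mulr_ge0 (ler0n _ 2) b0).
have K0 : 0 <= K by exact: le_trans K1.
have m2 : 0 < `|m| ^+ 2 by rewrite exprn_gt0// normr_gt0.
pose q := D ^+ 2 * K / `|m| ^+ 2.
have [M HM] := exists_nat_gt (q ^+ 2).
pose n := maxn (maxn N M) 1.
have nN : (N <= n)%N by rewrite !leq_max leqnn.
have nM : (M <= n)%N by rewrite !leq_max leqnn orbT.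
have n1 : (1 <= n)%N by rewrite leq_max leqnn orbT.
have n1' : 1 <= n%:R :> R by rewrite ler1n.
pose s : R := Num.sqrt n%:R.
have s0 : 0 < s by rewrite sqrtr_gt0 (lt_le_trans ltr01).
have sE : n%:R = s ^+ 2 by rewrite sqr_sqrtr.
suff sq : s <= q.
  have := HM n nM; rewrite sE ltNge => /negP; apply.
  by rewrite lerXn2r ?nnegrE ?(ltW s0)// (le_trans _ sq)// ltW.
rewrite ler_pdivlMr// -(@ler_pM2r _ (s ^+ 3)) ?exprn_gt0//.
have nm0 : 0 <= n%:R * `|m| by rewrite mulr_ge0.
have Dg0 : 0 <= D * growth b n := le_trans nm0 (H n nN).
have h : (n%:R * `|m|) ^+ 2 <= (D * growth b n) ^+ 2.
  by rewrite ler_pXn2r ?nnegrE// H.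
apply: (@le_trans _ _ ((n%:R * `|m|) ^+ 2)).
  rewrite exprMn sE -exprM le_eqVlt; apply/orP; left; apply/eqP; ring.
apply: (le_trans h).
rewrite exprMn /growth exprMn -powR_sqr ?(ltW (logplus_gt0 _))//.
have := HK n%:R n1'; rewrite -/s => {}HK.
rewrite -[leRHS]mulrA ler_wpM2l ?sqr_ge0//.
rewrite (_ : K * s ^+ 3 = s ^+ 2 * (K * s)); last by ring.
by rewrite ler_wpM2l ?sqr_ge0.
Qed.

End calculus.

(** * Independence of the past and the next coordinate *)

Section independence.
Context {d : measure_display} {T : measurableType d} {R : realType}
        {P : probability T R}.

Lemma measurable_preimage_RV (Y : {RV P >-> R}) (B : set R) :
  measurable B -> measurable (Y @^-1` B).
Proof. by move=> mB; exact: measurable_funPTI. Qed.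

Lemma mutually_independent_seq {I : choiceType} (X : I -> {RV P >-> R}) :
  mutually_independent X ->
  forall (s : seq I) (B : I -> set R), uniq s -> (forall i, measurable (B i)) ->
  P (\big[setI/setT]_(i <- s) (X i @^-1` B i)) =
  (\prod_(i <- s) P (X i @^-1` B i))%E.
Proof.
move=> indX s B us mB; have := indX [fset i in s]%fset B (fun i _ => mB i).
have -> : \bigcap_(i in [set` [fset i in s]%fset]) X i @^-1` B i =
    \big[setI/setT]_(i <- s) (X i @^-1` B i).
  rewrite -bigcap_seq (_ : [set` [fset i in s]%fset] = [set` s])//.
  by apply/seteqP; split=> i /=; rewrite inE.
move=> ->; apply: perm_big; rewrite uniq_perm ?fset_uniq// => i.
by rewrite inE.
Qed.

(** The factorisation on rectangles says that the law of [(Z, Y)] is the product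
    of the laws of [Z] and [Y]; the claim is then Tonelli's theorem.  [Z] may
    take values in an arbitrary measurable space, in particular in [T] equipped
    with a smaller sigma-algebra. *)
Lemma ge0_integral_indep {d1 d2 : measure_display} {T1 : measurableType d1}
    {T2 : measurableType d2} (Z : {mfun T >-> T1}) (Y : {mfun T >-> T2})
    (f : T1 -> R) (h : T2 -> R) :
  (forall A B, measurable A -> measurable B ->
    P (Z @^-1` A `&` Y @^-1` B) = (P (Z @^-1` A) * P (Y @^-1` B))%E) ->
  measurable_fun setT f -> (forall x, 0 <= f x) ->
  measurable_fun setT h -> (forall y, 0 <= h y) ->
  (\int[P]_w (f (Z w) * h (Y w))%:E =
   \int[P]_w (f (Z w))%:E * \int[P]_w (h (Y w))%:E)%E.
Proof.
move=> indep mf f0 mh h0.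
have mZY : measurable_fun setT (fun w => (Z w, Y w)).
  by apply/measurable_fun_pairP; split; exact: measurable_funP.
pose ZY : {mfun T >-> (T1 * T2)%type} :=
  HB.pack (fun w => (Z w, Y w)) (isMeasurableFun.Build _ _ _ _ _ mZY).
pose g : T1 * T2 -> \bar R := fun z => (f z.1 * h z.2)%:E.
have mg : measurable_fun setT g.
  apply/measurable_EFinP; apply: measurable_funM.
    by apply: measurableT_comp => //; exact: measurable_fst.
  by apply: measurableT_comp => //; exact: measurable_snd.
have g0 z : (0 <= g z)%E by rewrite lee_fin mulr_ge0.
have prodE C : measurable C ->
    (distribution P Z \x distribution P Y)%E C = distribution P ZY C.
  apply: product_measure_unique => A B mA mB.
  by rewrite /distribution /pushforward /= -indep.
transitivity (\int[distribution P ZY]_z g z)%E.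
  by rewrite ge0_integral_distribution.
transitivity (\int[distribution P Z \x distribution P Y]_z g z)%E.
  by apply: eq_measure_integral => C mC _; exact/esym/prodE.
rewrite fubini_tonelli1//= /fubini_F/=.
transitivity (\int[distribution P Z]_x
    ((f x)%:E * \int[distribution P Y]_y (h y)%:E))%E.
  apply: eq_integral => x _; rewrite /g/=.
  under eq_integral do rewrite EFinM.
  rewrite ge0_integralZl_EFin//; first by move=> y _; rewrite lee_fin.
  exact/measurable_EFinP.
have I0 : (0 <= \int[distribution P Y]_y (h y)%:E)%E.
  by apply: integral_ge0 => y _; rewrite lee_fin.
rewrite ge0_integralZr//; first last.
- by move=> x _; rewrite lee_fin.
- exact/measurable_EFinP.
rewrite !ge0_integral_distribution//.
- exact/measurable_EFinP.
- exact/measurable_EFinP.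
Qed.

Variable X : nat -> {RV P >-> R}.
Hypothesis indX : mutually_independent X.

(** A pi-system generating the sigma-algebra of [X 1], ..., [X n]. *)
Definition cylinder (n : nat) : set (set T) :=
  [set A | exists2 B : nat -> set R, forall i, measurable (B i) &
    A = \big[setI/setT]_(i <- iota 1 n) (X i @^-1` B i)].

Lemma cylinder_setI n : setI_closed (cylinder n).
Proof.
move=> _ _ [B mB ->] [C mC ->]; exists (fun i => B i `&` C i).
  by move=> i; exact: measurableI.
by rewrite -big_split/=.
Qed.

Lemma cylinder_measurable n : cylinder n `<=` measurable.
Proof.
move=> _ [B mB ->]; rewrite -bigcap_seq; apply: fin_bigcap_measurable => //.
by move=> i _; exact: measurable_preimage_RV.
Qed.

Lemma cylinder_coordinate n i (B : set R) : (0 < i <= n)%N -> measurable B ->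
  cylinder n (X i @^-1` B).
Proof.
move=> /andP[i0 iin] mB; exists (fun j => if j == i then B else setT).
  by move=> j; case: ifP.
rewrite -bigcap_seq; apply/seteqP; split => w.
  by move=> Bw j _ /=; case: ifPn => // /eqP->.
by move=> /(_ i) /=; rewrite eqxx; apply; rewrite mem_iota i0 add1n ltnS.
Qed.

(** A pi-lambda argument: for fixed [B] both sides are finite measures in [A],
    and on cylinders they agree by the product rule. *)
Lemma past_indep n (A : set T) (B : set R) :
  <<s cylinder n >> A -> measurable B ->
  P (A `&` X n.+1 @^-1` B) = (P A * P (X n.+1 @^-1` B))%E.
Proof.
move=> sA mB; have mXB := measurable_preimage_RV (X n.+1) B mB.
have p0 : (0 <= fine (P (X n.+1 @^-1` B))) by rewrite fine_ge0.
have pE : P (X n.+1 @^-1` B) = (NngNum p0)%:num%:E by rewrite /= fineK ?fin_num_measure.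
rewrite pE muleC.
have := @g_sigma_algebra_measure_unique _ R T (cylinder n)
  (cylinder_measurable n) (fun=> setT) _ _ (mrestr P mXB)
  (mscale (NngNum p0) P) (cylinder_setI n) _ _ A sA.
apply.
- by move=> i; exists (fun=> setT) => //; rewrite big1.
- by rewrite bigcup_const.
- move=> _ [C mC ->].
  set A0 := \big[setI/setT]_(i <- _) _.
  change (P (A0 `&` X n.+1 @^-1` B) = ((NngNum p0)%:num%:E * P A0)%E).
  rewrite -pE /A0 {A0}.
  pose C' i := if i == n.+1 then B else C i.
  have CC' i : i \in iota 1 n -> C' i = C i.
    by rewrite mem_iota /C' add1n ltnS => /andP[_ ni]; rewrite ltn_eqF.
  have -> : \big[setI/setT]_(i <- iota 1 n) X i @^-1` C i =
      \big[setI/setT]_(i <- iota 1 n) X i @^-1` C' i.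
    by apply: eq_big_seq => i /CC' ->.
  have mC' i : measurable (C' i) by rewrite /C'; case: ifP.
  have -> : X n.+1 @^-1` B = X n.+1 @^-1` C' n.+1 by rewrite /C' eqxx.
  have := mutually_independent_seq X indX (iota 1 n.+1) C' (iota_uniq _ _) mC'.
  have -> : iota 1 n.+1 = iota 1 n ++ [:: n.+1] by rewrite -(addn1 n) iotaD addnC.
  rewrite !big_cat/= !big_seq1 => ->.
  by rewrite mutually_independent_seq ?iota_uniq// muleC.
- move=> k; change (P (setT `&` X n.+1 @^-1` B) < +oo)%E; rewrite setTI.
  by rewrite -ge0_fin_numE ?measure_ge0 ?fin_num_measure.
Qed.

End independence.

(** * Series and Borel-Cantelli lemmas *)

Section series.
Context {R : realType}.

Lemma nneseries_le (u : nat -> R) (M : R) : (forall n, 0 <= u n) ->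
  (forall n, \sum_(0 <= i < n) u i <= M) -> (\sum_(i <oo) (u i)%:E <= M%:E)%E.
Proof.
move=> u0 uM; apply: lime_le.
  by apply: is_cvg_nneseries => n _ _; rewrite lee_fin.
by apply: nearW => n; rewrite sumEFin lee_fin.
Qed.

Lemma nneseries_unbounded (u : nat -> R) (M : R) : (forall n, 0 <= u n) ->
  (\sum_(i <oo) (u i)%:E = +oo)%E -> exists n, M < \sum_(0 <= i < n) u i.
Proof.
move=> u0 uoo; apply: contrapT => /forallNP uM.
have : (\sum_(i <oo) (u i)%:E <= M%:E)%E.
  by apply: nneseries_le => // n; rewrite leNgt; apply/negP.
by rewrite uoo leye_eq.
Qed.

End series.

Section borel_cantelli.
Context {d : measure_display} {T : measurableType d} {R : realType}
        {P : probability T R}.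

Lemma borel_cantelli_eventually (E : nat -> set T) :
  (forall k, measurable (E k)) -> (\sum_(k <oo) P (E k) < +oo)%E ->
  {ae P, forall w, exists k0, forall k, (k0 <= k)%N -> ~ E k w}.
Proof.
move=> mE SE; exists (lim_sup_set E); split.
- apply: bigcap_measurable => [|n _]; first by exists 0%N.
  by apply: bigcup_measurable => k _.
- exact: lim_sup_set_cvg0.
- move=> w /= + n _; move=> /forallNP/(_ n) /existsNP[k] /not_implyP[nk].
  by move/contrapT => Ekw; exists k.
Qed.

(** The probability that no event occurs between [m] and [m + k] is
    [\prod (1 - p i) <= exp (- \sum p i)], which is as small as desired. *)
Lemma borel_cantelli_indep (X : nat -> {RV P >-> R}) (B : nat -> set R) :
  mutually_independent X -> (forall n, measurable (B n)) ->
  (\sum_(n <oo) P (X n @^-1` B n) = +oo)%E ->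
  {ae P, forall w m, exists2 n, (m <= n)%N & B n (X n w)}.
Proof.
move=> indX mB Soo; apply: ae_foralln => m.
pose p n := fine (P (X n @^-1` B n)).
have pE n : P (X n @^-1` B n) = (p n)%:E.
  by rewrite /p fineK// fin_num_measure//; exact: measurable_preimage_RV.
have p0 n : 0 <= p n by rewrite -lee_fin -pE.
pose N := \bigcap_(n in [set n | (m <= n)%N]) (X n @^-1` (~` B n)).
have mN : measurable N.
  apply: bigcap_measurable; first by exists m => /=.
  by move=> n _; apply: measurable_preimage_RV; exact: measurableC.
have PN M : 0 <= M -> (P N <= (expR (- M))%:E)%E.
  move=> M0.
  have [k Mk] : exists k, M + \sum_(0 <= i < m) p i < \sum_(0 <= i < k) p i.
    by apply: nneseries_unbounded => //; under eq_eseriesr do rewrite -pE.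
  (* finitely many of the events, so that the product rule applies *)
  apply: (@le_trans _ _ (P (\big[setI/setT]_(i <- iota m k)
      (X i @^-1` (~` B i))))).
    apply: le_measure; rewrite ?inE//.
      rewrite -bigcap_seq; apply: fin_bigcap_measurable => //.
      by move=> i _; apply: measurable_preimage_RV; exact: measurableC.
    rewrite -bigcap_seq => w Nw i /=; rewrite mem_iota => /andP[mi _].
    exact: Nw.
  rewrite mutually_independent_seq ?iota_uniq//; last first.
    by move=> i; exact: measurableC.
  have PC i : P (X i @^-1` (~` B i)) = (1 - p i)%:E.
    rewrite preimage_setC probability_setC ?pE//.
    exact: measurable_preimage_RV.
  under eq_bigr do rewrite PC.
  rewrite prodEFin lee_fin.
  apply: (@le_trans _ _ (\prod_(i <- iota m k) expR (- p i))).
    apply: ler_prod => i _; rewrite -[1 - p i]/(1 + - p i) expR_ge1Dx andbT.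
    by rewrite -lee_fin -PC.
  rewrite -expR_sum ler_expR sumrN lerN2.
  rewrite -(lerD2r (\sum_(0 <= i < m) p i)) (le_trans (ltW Mk))//.
  rewrite addrC -[iota m k]/(iota m k).
  have -> : \sum_(i <- iota m k) p i = \sum_(m <= i < m + k) p i.
    by rewrite /index_iota addKn.
  rewrite -big_cat_nat ?leq_addr//= (@big_cat_nat _ _ _ k 0 (m + k))//=.
    by rewrite lerDl sumr_ge0.
  exact: leq_addl.
exists N; split => //.
  apply/eqP; rewrite eq_le measure_ge0 andbT.
  apply/lee_addgt0Pr => e e0; rewrite add0e.
  have [e1|e1] := leP 1 e.
    apply: (le_trans (PN 0 (lexx _))); rewrite oppr0 expR0 lee_fin//.
  have := PN (- ln e); rewrite opprK lnK ?posrE//; apply.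
  by rewrite oppr_ge0 ln_le0// ltW.
move=> w /= nex n /= mn Bn; apply: nex.
by exists n.
Qed.

End borel_cantelli.

(** * An exponential maximal inequality *)

Section maximal_inequality.
Context {R : realType}.

(** Time 0 imposes no condition, so that [t] may be any real number. *)
Fixpoint stays_below {U : Type} (y : nat -> U -> R) (t : R) (n : nat) (u : U) :=
  if n is n'.+1 then
    stays_below y t n' u && (\sum_(1 <= i < n.+1) y i u < t)
  else true.

Lemma not_stays_below {U : Type} (y : nat -> U -> R) t n j u :
  (0 < j <= n)%N -> t <= \sum_(1 <= i < j.+1) y i u -> ~~ stays_below y t n u.
Proof.
move=> jn yt; elim: n jn => [|n IH]; first by case: j yt.
move=> /andP[j0]; rewrite leq_eqVlt => /predU1P[jn|jn].
  by rewrite /= -jn ltNge yt andbF.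
by rewrite /= negb_and IH// j0.
Qed.

Lemma measurable_walk {dU : measure_display} {U : measurableType dU}
    (y : nat -> U -> R) n :
  (forall i, (0 < i <= n)%N -> measurable_fun setT (y i)) ->
  measurable_fun setT (fun u => \sum_(1 <= i < n.+1) y i u).
Proof.
move=> my; pose z i : U -> R := if (0 < i <= n)%N then y i else fun=> 0.
rewrite [X in measurable_fun _ X](_ : _ = fun u => \sum_(i <- iota 1 n) z i u).
  by apply: measurable_sum => i; rewrite /z; case: ifPn => // /my.
apply/funext => u; rewrite /index_iota subSS subn0.
by apply: eq_big_seq => i; rewrite mem_iota add1n ltnS /z => ->.
Qed.

Lemma measurable_stays_below {dU : measure_display} {U : measurableType dU}
    (y : nat -> U -> R) t n :
  (forall i, (0 < i <= n)%N -> measurable_fun setT (y i)) ->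
  measurable_fun setT (stays_below y t n).
Proof.
elim: n => [|n IH] my; first exact: measurable_cst.
apply: measurable_and.
  by apply: IH => i /andP[i0 iin]; apply: my; rewrite i0 ltnW.
apply: measurable_fun_ltr => //.
by apply: measurable_walk.
Qed.

Definition killed_exp {U : Type} (y : nat -> U -> R) (t : R) (n : nat) (u : U) :=
  if stays_below y t n u then expR (\sum_(1 <= i < n.+1) y i u) else 0.

Lemma measurable_killed_exp {dU : measure_display} {U : measurableType dU}
    (y : nat -> U -> R) t n :
  (forall i, (0 < i <= n)%N -> measurable_fun setT (y i)) ->
  measurable_fun setT (killed_exp y t n).
Proof.
move=> my; apply: measurable_fun_ifT => //.
  exact: measurable_stays_below.
apply: measurableT_comp => //.
by apply: measurable_walk.
Qed.

Context {d : measure_display} {T : measurableType d} {P : probability T R}.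

(** Doob's inequality for the exponential of a walk.  Freezing the exponential
    at the value [expR t] once the level [t] is reached gives a process,
    [U + K] below, whose mean grows at most by the factor [m] at each step: while
    the walk is below [t] the next increment is independent of the past.  At time
    [n] this process is at least [expR t] on the event that [t] was reached. *)
Lemma exponential_maximal_inequality (X : nat -> {RV P >-> R}) (g : R -> R)
    (m t : R) (n : nat) :
  mutually_independent X -> measurable_fun setT g -> 1 <= m ->
  (forall i, (\int[P]_w (expR (g (X i w)))%:E <= m%:E)%E) ->
  (P [set w | ~~ stays_below (fun i w => g (X i w)) t n w] <=
   (m ^+ n * expR (- t))%:E)%E.
Proof.
move=> indX mg m1 Em; pose y i w := g (X i w).
have m0 : 0 <= m by exact: le_trans m1.
have my i : measurable_fun setT (y i) by apply: measurableT_comp.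
pose U k := killed_exp y t k.
pose K k w := if stays_below y t k w then 0 else expR t.
have U0 k w : 0 <= U k w by rewrite /U /killed_exp; case: ifP; rewrite ?expR_ge0.
have K0 k w : 0 <= K k w by rewrite /K; case: ifP; rewrite ?expR_ge0.
have mU k : measurable_fun setT (U k).
  by apply: measurable_killed_exp => i _; exact: my.
have mK k : measurable_fun setT (K k).
  apply: measurable_fun_ifT => //.
  by apply: measurable_stays_below => i _; exact: my.
have EU k : (\int[P]_w (U k w * expR (y k.+1 w))%:E =
    \int[P]_w (U k w)%:E * \int[P]_w (expR (y k.+1 w))%:E)%E.
  (* the past is the identity of [T] seen as a map to [T] with fewer events *)
  pose F := g_sigma_algebraType (cylinder X k).
  have mid : measurable_fun setT (fun w : T => w : F).
    move=> _ A mA; rewrite setTI preimage_id.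
    have := mA; apply: smallest_sub; first exact: sigma_algebra_measurable.
    exact: cylinder_measurable.
  pose Z : {mfun T >-> F} := HB.pack (fun w : T => w : F)
    (isMeasurableFun.Build _ _ T F _ mid).
  apply: (@ge0_integral_indep _ _ _ _ _ _ _ _ Z (X k.+1)
    (fun u : F => killed_exp y t k u) (fun x => expR (g x))) => //.
  - by move=> A B mA mB; exact: past_indep.
  - apply: (@measurable_killed_exp _ F y) => i ik.
    apply: (measurableT_comp mg).
    move=> _ B mB; rewrite setTI.
    by apply: sub_sigma_algebra; exact: cylinder_coordinate.
  - by apply: measurableT_comp.
(* when [t] is crossed at time [k.+1], the exponential is at least [expR t] *)
have step k : (\int[P]_w (U k.+1 w + K k.+1 w)%:E <=
    m%:E * \int[P]_w (U k w + K k w)%:E)%E.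
  apply: (@le_trans _ _ (\int[P]_w ((U k w * expR (y k.+1 w))%:E + (K k w)%:E))%E).
    apply: ge0_le_integral => //.
    - by move=> w _; rewrite lee_fin addr_ge0.
    - by apply/measurable_EFinP; exact: measurable_funD.
    - apply/measurable_EFinP; apply: measurable_funD => //.
      by apply: measurable_funM => //; exact: measurableT_comp.
    - move=> w _; rewrite lee_fin /U /K /killed_exp /=.
      case: (stays_below y t k w) => /=; last by rewrite mul0r.
      rewrite -expRD -big_nat_recr//= addr0.
      by case: ltP => h; rewrite ?addr0// add0r ler_expR.
  rewrite ge0_integralD//; first last.
  - exact/measurable_EFinP.
  - by move=> w _; rewrite lee_fin.
  - by apply/measurable_EFinP; apply: measurable_funM => //; exact: measurableT_comp.
  - by move=> w _; rewrite lee_fin mulr_ge0// expR_ge0.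
  rewrite EU; under [in leRHS]eq_integral do rewrite EFinD.
  rewrite ge0_integralD//; first last.
  - exact/measurable_EFinP.
  - by move=> w _; rewrite lee_fin.
  - exact/measurable_EFinP.
  - by move=> w _; rewrite lee_fin.
  have IU : (0 <= \int[P]_w (U k w)%:E)%E.
    by apply: integral_ge0 => w _; rewrite lee_fin.
  have IK : (0 <= \int[P]_w (K k w)%:E)%E.
    by apply: integral_ge0 => w _; rewrite lee_fin.
  rewrite [leRHS]ge0_muleDr//; apply: leeD.
    by rewrite muleC lee_wpmul2r//; exact: Em.
  by rewrite -[leLHS]mul1e lee_wpmul2r// lee_fin.
have EV k : (\int[P]_w (U k w + K k w)%:E <= (m ^+ k)%:E)%E.
  elim: k => [|k IH].
    under eq_integral do rewrite /U /K /killed_exp /= big_nil expR0 addr0.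
    by rewrite integral_cst// mul1e expr0; exact: probability_le1.
  apply: (le_trans (step k)); rewrite exprS EFinM lee_wpmul2l// lee_fin//.
have mA : measurable [set w | ~~ stays_below y t n w].
  have := @measurable_stays_below _ T y t n (fun i _ => my i).
  move=> /(_ measurableT [set false] I); rewrite setTI.
  by congr (measurable _); apply/seteqP; split => w /=; case: stays_below.
rewrite EFinM -lee_pdivrMr ?expR_gt0// -expRN opprK.
apply: le_trans (EV n).
rewrite muleC -integral_cst//.
rewrite [leLHS]integral_mkcond/=.
apply: ge0_le_integral => //.
- move=> w _; rewrite patchE; case: ifP => //; rewrite lee_fin expR_ge0//.
- by apply/(measurable_restrictT _ mA); exact: measurable_cst.
- by apply/measurable_EFinP; exact: measurable_funD.
- move=> w _; rewrite patchE; case: ifPn => [|_].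
    by rewrite inE /= => /negbTE h; rewrite /K h lee_fin lerDr.
  by rewrite lee_fin addr_ge0.
Qed.

End maximal_inequality.

(** * Truncation and moments *)

Section measurability.
Context {R : realType}.

Lemma measurable_norm_gt (c : R) : measurable [set x : R | c < `|x|].
Proof.
have := @normr_measurable R setT measurableT `]c, +oo[%classic
  (measurable_itv _); rewrite setTI.
by congr (measurable _); apply/seteqP; split=> x /=; rewrite in_itv/= andbT.
Qed.

Lemma measurable_moment_weight (b : R) : measurable_fun setT (moment_weight b).
Proof.
apply: measurable_funM; first exact: measurable_funX.
rewrite [X in measurable_fun _ X](_ : _ =
  fun x : R => logplus `|x| `^ (- (2 * b))); last first.
  by apply/funext => x; rewrite powRN.
have mL : measurable_fun setT (fun x : R => logplus `|x|).
  apply: (measurableT_comp (@measurable_ln R)).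
  by apply: measurable_maxr => //; exact: normr_measurable.
exact: (measurableT_comp (measurable_powR (- (2 * b))) mL).
Qed.

Definition truncate (c x : R) : R := if `|x| <= c then x else 0.

Lemma measurable_truncate (c : R) : measurable_fun setT (truncate c).
Proof.
apply: measurable_fun_ifT => //.
by apply: measurable_fun_ler => //; exact: normr_measurable.
Qed.

Lemma truncate_le (c x : R) : 0 <= c -> `|truncate c x| <= c.
Proof. by move=> c0; rewrite /truncate; case: ifPn => //; rewrite normr0. Qed.

(** From [expR (- u) >= 1 - u] by inversion, as
    [(1 + u + 2 * u ^ 2) * (1 - u) = 1 + u ^ 2 * (1 - 2 * u)]. *)
Lemma expR_le_quadratic (u : R) : u <= 2^-1 -> expR u <= 1 + u + 2 * u ^+ 2.
Proof.
move=> u2; have h : 1 - u <= expR (- u) by exact: expR_ge1Dx.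
have u0 : 0 < 1 - u by lra.
rewrite -[u in leLHS]opprK expRN -[leLHS]mul1r ler_pdivrMr ?expR_gt0//.
have q0 : 0 <= 1 + u + 2 * u ^+ 2 by nra.
apply: (@le_trans _ _ ((1 + u + 2 * u ^+ 2) * (1 - u))); last by rewrite ler_wpM2l.
have : 0 <= u ^+ 2 * (1 - 2 * u) by rewrite mulr_ge0 ?sqr_ge0//; lra.
by nra.
Qed.

End measurability.

Section moments.
Context {d : measure_display} {T : measurableType d} {R : realType}
        {P : probability T R}.

Lemma bounded_integrable (W : T -> R) (C : R) :
  measurable_fun setT W -> (forall w, `|W w| <= C) ->
  P.-integrable setT (EFin \o W).
Proof.
move=> mW WC; apply: measurable_bounded_integrable => //.
  by rewrite -ge0_fin_numE ?measure_ge0 ?fin_num_measure.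
exists C; split; first exact: num_real.
by move=> y Cy w _ /=; apply: le_trans (WC w) (ltW Cy).
Qed.

(** Integrate the quadratic upper bound of the exponential and apply
    [1 + x <= expR x]; centring costs the factor [expR (- m)]. *)
Lemma exp_moment_le (W : T -> R) (m v : R) :
  measurable_fun setT W -> (forall w, `|W w| <= 2^-1) ->
  (\int[P]_w (W w)%:E = m%:E)%E ->
  (\int[P]_w (W w ^+ 2)%:E <= v%:E)%E ->
  (\int[P]_w (expR (W w - m))%:E <= (expR (2 * v))%:E)%E.
Proof.
move=> mW W2 Em Ev.
have Wle w : - 2^-1 <= W w <= 2^-1 by rewrite -ler_norml.
have iW := bounded_integrable W _ mW W2.
have mW2 : measurable_fun setT (fun w => 2 * W w ^+ 2).
  by apply: measurable_funM => //; exact: measurable_funX.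
have mW1 : measurable_fun setT (fun w => 1 + W w) by exact: measurable_funD.
have E1 : (\int[P]_w (1 + W w)%:E = (1 + m)%:E)%E.
  under eq_integral do rewrite EFinD.
  rewrite (@integralD _ _ _ P setT measurableT (cst 1%E) (EFin \o W))//; last first.
    exact: (finite_measure_integrable_cst P 1 measurableT).
  rewrite Em (_ : \int[P]_x cst 1%E x = 1)%E//.
  by rewrite integral_cst// mul1e; exact: probability_setT.
have Eexp : (\int[P]_w (expR (W w))%:E <= (1 + m + 2 * v)%:E)%E.
  apply: (@le_trans _ _ (\int[P]_w ((1 + W w)%:E + (2 * W w ^+ 2)%:E))%E).
    apply: ge0_le_integral => //.
    - by apply/measurable_EFinP; exact: measurableT_comp.
    - by apply: emeasurable_funD; exact/measurable_EFinP.
    - move=> w _; rewrite -EFinD lee_fin.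
      by have /andP[_] := Wle w; exact: expR_le_quadratic.
  rewrite ge0_integralD//; first last.
  - exact/measurable_EFinP.
  - by move=> w _; rewrite lee_fin mulr_ge0// sqr_ge0.
  - exact/measurable_EFinP.
  - by move=> w _; rewrite lee_fin; have := Wle w; lra.
  rewrite E1 [leRHS]EFinD leeD2l//.
  under eq_integral do rewrite EFinM.
  rewrite ge0_integralZl_EFin//; first by rewrite EFinM lee_wpmul2l.
  - by move=> w _; rewrite lee_fin sqr_ge0.
  - by apply/measurable_EFinP; exact: measurable_funX.
under eq_integral do rewrite addrC expRD EFinM.
rewrite ge0_integralZl_EFin ?expR_ge0//; first last.
- by apply/measurable_EFinP; exact: measurableT_comp.
apply: (@le_trans _ _ ((expR (- m))%:E * (1 + m + 2 * v)%:E)%E).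
  by rewrite lee_wpmul2l// lee_fin expR_ge0.
have -> : expR (2 * v) = expR (- m + (m + 2 * v)) by congr expR; ring.
rewrite -EFinM lee_fin [leRHS]expRD ler_wpM2l ?expR_ge0// -addrA.
exact: expR_ge1Dx.
Qed.

Lemma identically_distributed_integral (X : nat -> {RV P >-> R}) (h : R -> R) :
  identically_distributed X -> measurable_fun setT h -> (forall x, 0 <= h x) ->
  forall i, (\int[P]_w (h (X i w))%:E = \int[P]_w (h (X 0%N w))%:E)%E.
Proof.
move=> idX mh h0 i.
have := fun j => @ge0_integral_distribution _ _ _ _ _ P (X j) (EFin \o h).
have mEh : measurable_fun setT (EFin \o h) by exact/measurable_EFinP.
have Eh0 y : (0 <= (EFin \o h) y)%E by rewrite lee_fin.
move=> eqd; have := eqd i mEh Eh0; have := eqd 0%N mEh Eh0.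
rewrite /comp/= => <- <-.
by apply: eq_measure_integral => B mB _; exact: idX.
Qed.

(** The sum is geometric up to the last index that contributes, and that one
    term is at most [y]. *)
Lemma sum_dyadic_le (n : nat) (y : R) (p : nat -> bool) : 0 <= y ->
  (forall k, p k -> 2 ^+ k <= y) ->
  \sum_(0 <= k < n) 2 ^+ k * (p k)%:R <= 2 * y.
Proof.
move=> y0 py.
suff key : \sum_(0 <= k < n) 2 ^+ k * (p k)%:R <= 2 * y /\
           \sum_(0 <= k < n) 2 ^+ k * (p k)%:R <= 2 ^+ n :> R by case: key.
elim: n => [|n [IH1 IH2]]; first by rewrite big_nil mulr_ge0 ?exprn_ge0.
rewrite big_nat_recr//=; case: (boolP (p n)) => [/py pn|_].
  by rewrite mulr1 exprS; lra.
rewrite mulr0 addr0; split => //.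
have : 0 <= 2 ^+ n :> R by rewrite exprn_ge0.
by rewrite exprS; lra.
Qed.

(** By [above_trunc_level] the indices [k] that contribute at a given point
    satisfy [2 ^ k <= K * moment_weight b (Y w)]; so the sum is pointwise at most
    a multiple of the weight. *)
Lemma tail_series_lty (Y : {RV P >-> R}) (b : R) : 0 <= b ->
  (\int[P]_w (moment_weight b (Y w))%:E < +oo)%E ->
  (\sum_(k <oo) (2 ^+ k.+1)%:E * P [set w | (trunc_level b k < `|Y w|)%R]
    < +oo)%E.
Proof.
move=> b0 Moo.
have [K K1 HK] := above_trunc_level b b0.
have K0 : 0 <= K by exact: le_trans K1.
pose A k := [set w | trunc_level b k < `|Y w|].
have mA k : measurable (A k).
  exact: (measurable_preimage_RV Y _ (measurable_norm_gt (trunc_level b k))).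
pose u k w : R := 2 * (2 ^+ k * (trunc_level b k < `|Y w|)%R%:R).
have u0 k w : 0 <= u k w by rewrite /u !mulr_ge0 ?exprn_ge0.
have uE k w : u k w = 2 ^+ k.+1 * \1_(A k) w.
  rewrite /u exprS mulrA indicE; congr (_ * (_ : bool)%:R).
  by apply/idP/idP; rewrite inE.
have mu k : measurable_fun setT (u k).
  rewrite (_ : u k = fun w => 2 ^+ k.+1 * \1_(A k) w); last exact/funext.
  by apply: measurable_funM => //; exact: measurable_indic.
have mM : measurable_fun setT (fun w => moment_weight b (Y w)).
  by apply: (measurableT_comp (measurable_moment_weight b)).
apply: (@le_lt_trans _ _ (\int[P]_w \sum_(k <oo) (u k w)%:E)%E).
  rewrite integral_nneseries//; first last.
  - by move=> k w _; rewrite lee_fin.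
  - by move=> k; exact/measurable_EFinP.
  apply: lee_nneseries => k _ //.
  - by rewrite mule_ge0// lee_fin exprn_ge0.
  - under eq_integral do rewrite uE EFinM.
    rewrite ge0_integralZl_EFin ?exprn_ge0//; first last.
    + by apply/measurable_EFinP; exact: measurable_indic.
    by rewrite integral_indic// setIT.
apply: (@le_lt_trans _ _ (\int[P]_w ((4 * K)%:E * (moment_weight b (Y w))%:E))%E).
  apply: ge0_le_integral => //.
  - by move=> w _; apply: nneseries_ge0 => k _ _; rewrite lee_fin.
  - apply: ge0_emeasurable_sum => [k x _ _|k _]; first by rewrite lee_fin.
    exact/measurable_EFinP.
  - by apply/measurable_EFinP; exact: measurable_funM.
  - move=> w _; rewrite -EFinM; apply: nneseries_le => // n.
    rewrite -mulr_sumr (_ : 4 * K * _ = 2 * (2 * (K * moment_weight b (Y w)))); last by ring.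
    rewrite ler_wpM2l//; apply: sum_dyadic_le.
      by rewrite mulr_ge0// moment_weight_ge0.
    by move=> k /HK[+ _]; rewrite moment_weight_norm.
rewrite ge0_integralZl_EFin ?mulr_ge0//; first last.
- exact/measurable_EFinP.
- by move=> w _; rewrite lee_fin moment_weight_ge0.
by rewrite lte_mul_pinfty// lee_fin mulr_ge0.
Qed.

End moments.

Section stretched.
Context {R : realType}.

Lemma sum_telescope_le1 (n : nat) :
  \sum_(0 <= k < n) (k.+1%:R * k.+2%:R)^-1 <= 1 :> R.
Proof.
have -> : \sum_(0 <= k < n) (k.+1%:R * k.+2%:R)^-1 = 1 - n.+1%:R^-1 :> R.
  elim: n => [|n IH]; first by rewrite big_nil invr1 subrr.
  rewrite big_nat_recr//= IH.
  have key (x : R) : 0 < x -> 1 - x^-1 + (x * (x + 1))^-1 = 1 - (x + 1)^-1.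
    by move=> x0; field; rewrite !gt_eqF// addr_gt0.
  by rewrite -[n.+2%:R]natr1 key.
by rewrite gerBl invr_ge0.
Qed.

(** The terms are [O(1 / k ^ 2)]; the series of the
    [1 / ((k + 1) * (k + 2))] telescopes. *)
Lemma stretched_exp_series_lty (e : R) : 0 < e ->
  (\sum_(k <oo) (expR (- (k.+1%:R `^ e)))%:E < +oo)%E.
Proof.
move=> e0; have [K K0 HK] := @powR_le_expR R (2 / e) 1
  (divr_ge0 (ler0n _ 2) (ltW e0)) ltr01.
apply: (@le_lt_trans _ _ (2 * K)%:E); last exact: ltry.
apply: nneseries_le => [n|n]; first exact: expR_ge0.
apply: (@le_trans _ _ (\sum_(0 <= k < n) 2 * K * (k.+1%:R * k.+2%:R)^-1)).
  apply: ler_sum => k _; rewrite expRN -[leLHS]mul1r ler_pdivrMr ?expR_gt0//.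
  have := HK (k.+1%:R `^ e) (powR_ge0 _ _).
  rewrite -powRrM mulrCA divff ?gt_eqF// mulr1 mul1r powR_mulrn// => h.
  rewrite mulrAC ler_pdivlMr ?mulr_gt0// mul1r.
  have k2 : k.+2%:R <= 2 * k.+1%:R :> R.
    have k1 : 1 <= k.+1%:R :> R by rewrite ler1n.
    by rewrite -[k.+2%:R]natr1; lra.
  have k1 : 0 <= k.+1%:R :> R by [].
  rewrite -mulrA; apply: le_trans (_ : 2 * k.+1%:R ^+ 2 <= _); last by rewrite ler_wpM2l.
  by rewrite expr2 mulrCA ler_wpM2l.
rewrite -mulr_sumr -[leRHS]mulr1 ler_wpM2l ?mulr_ge0 ?(ltW K0)//.
exact: sum_telescope_le1.
Qed.

End stretched.

Section truncation.
Context {d : measure_display} {T : measurableType d} {R : realType}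
        {P : probability T R}.
Variables (Y : {RV P >-> R}) (b : R).
Hypothesis b0 : 0 <= b.
Hypothesis Moo : (\int[P]_w (moment_weight b (Y w))%:E < +oo)%E.

Let mY : measurable_fun setT Y := measurable_funP Y.

Let mM : measurable_fun setT (fun w => moment_weight b (Y w)).
Proof. exact: (measurableT_comp (measurable_moment_weight b) mY). Qed.

Let mt c : measurable_fun setT (fun w => truncate c (Y w)).
Proof. exact: (measurableT_comp (measurable_truncate c) mY). Qed.

Let iM : P.-integrable setT (fun w => (moment_weight b (Y w))%:E).
Proof.
apply/integrableP; split; first exact/measurable_EFinP.
by under eq_integral do rewrite gee0_abs ?lee_fin ?moment_weight_ge0//.
Qed.

Lemma integrable_of_moment : P.-integrable setT (EFin \o Y).
Proof.
have [K K0 HK] := norm_le_moment_weight b b0.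
have i1 := finite_measure_integrable_cst P (1 : R) measurableT.
have iK := integrableD measurableT i1 (integrableZl measurableT K iM).
apply: le_integrable iK => //; first exact/measurable_EFinP.
move=> w _; rewrite /= lee_fin [leRHS]ger0_norm//.
by rewrite addr_ge0// mulr_ge0// moment_weight_ge0.
Qed.

Lemma truncated_integrable k :
  P.-integrable setT (fun w => (truncate (trunc_level b k) (Y w))%:E).
Proof.
apply: (bounded_integrable _ (trunc_level b k)) => // w.
by apply: truncate_le; apply: le_trans (trunc_level_ge1 b k b0).
Qed.

Lemma truncated_second_moment : exists2 V, 0 <= V & forall k,
  (\int[P]_w (truncate (trunc_level b k) (Y w) ^+ 2)%:E <=
   (V * k.+1%:R `^ (2 * b))%:E)%E.
Proof.
pose M := fine (\int[P]_w (moment_weight b (Y w))%:E)%E.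
have M0 : (0 <= \int[P]_w (moment_weight b (Y w))%:E)%E.
  by apply: integral_ge0 => w _; rewrite lee_fin moment_weight_ge0.
have ME : (\int[P]_w (moment_weight b (Y w))%:E = M%:E)%E.
  by rewrite fineK// ge0_fin_numE.
exists ((1 + b) `^ (2 * b) * M); first by rewrite mulr_ge0 ?powR_ge0 ?fine_ge0.
move=> k.
have -> : (1 + b) `^ (2 * b) * M * k.+1%:R `^ (2 * b) =
    ((1 + b) * k.+1%:R) `^ (2 * b) * M.
  by rewrite powRM ?addr_ge0// mulrAC.
rewrite EFinM -ME -ge0_integralZl_EFin ?powR_ge0//; first last.
- exact/measurable_EFinP.
- by move=> w _; rewrite lee_fin moment_weight_ge0.
apply: ge0_le_integral => //.
- by move=> w _; rewrite lee_fin sqr_ge0.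
- by apply/measurable_EFinP; exact: measurable_funX.
- by apply/measurable_EFinP; exact: measurable_funM.
- move=> w _; rewrite -EFinM lee_fin /truncate; case: ifPn => [h|_].
    exact: below_trunc_level.
  by rewrite expr0n/= mulr_ge0 ?powR_ge0 ?moment_weight_ge0.
Qed.

(** Centring the truncated variables at their own mean instead of the mean of [Y]
    costs the integral of [`|Y|] above the level. *)
Lemma truncated_mean : exists2 C, 0 <= C & forall k,
  `| fine (\int[P]_w (truncate (trunc_level b k) (Y w))%:E) -
     fine (\int[P]_w (Y w)%:E) | <= C * (k.+1%:R `^ b / Num.sqrt (2 ^+ k)).
Proof.
have [K K1 HK] := above_trunc_level b b0.
have K0 : 0 <= K by exact: le_trans K1.
pose M := fine (\int[P]_w (moment_weight b (Y w))%:E)%E.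
have M0 : (0 <= \int[P]_w (moment_weight b (Y w))%:E)%E.
  by apply: integral_ge0 => w _; rewrite lee_fin moment_weight_ge0.
have ME : (\int[P]_w (moment_weight b (Y w))%:E = M%:E)%E.
  by rewrite fineK// ge0_fin_numE.
exists (K * M); first by rewrite mulr_ge0// fine_ge0.
move=> k; set c := trunc_level b k; set r := _ / _.
have r0 : 0 <= r by rewrite divr_ge0 ?powR_ge0 ?sqrtr_ge0.
have it := truncated_integrable k; have iY := integrable_of_moment.
rewrite -lee_fin -abse_EFin EFinB !fineK ?integrable_fin_num//.
rewrite -integralB//.
have imt : measurable_fun setT (fun w => (truncate c (Y w))%:E - (Y w)%:E)%E.
  by apply: emeasurable_funB; exact/measurable_EFinP.
apply: (le_trans (le_abse_integral _ _ _)) => //.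
rewrite (_ : K * M * r = K * r * M); last by ring.
rewrite EFinM -ME -ge0_integralZl_EFin ?mulr_ge0//; first last.
- exact/measurable_EFinP.
- by move=> w _; rewrite lee_fin moment_weight_ge0.
apply: ge0_le_integral => //.
- exact: measurableT_comp.
- by apply/measurable_EFinP; exact: measurable_funM.
- move=> w _; rewrite -EFinB -EFinM abse_EFin lee_fin /truncate.
  case: (leP `|Y w| c) => [_|cY].
    by rewrite subrr normr0; apply: mulr_ge0; [exact: mulr_ge0|exact: moment_weight_ge0].
  by have [_] := HK k `|Y w| cY; rewrite sub0r normrN moment_weight_norm.
Qed.

End truncation.

(** * Deviations from the mean *)

Section deviation.
Context {d : measure_display} {T : measurableType d} {R : realType}
        {P : probability T R}.
Variables (X : nat -> {RV P >-> R}) (b : R).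
Hypothesis hX : iid X.
Hypothesis b0 : 0 <= b.
Hypothesis Moo : (\int[P]_w (moment_weight b (X 0%N w))%:E < +oo)%E.

Let c k := trunc_level b k.
Let mu k := fine (\int[P]_w (truncate (c k) (X 0%N w))%:E)%E.

(** A truncated and centred summand, scaled so that before centring it is at most
    [1 / 2] in absolute value; the sign [s] serves the two tails. *)
Definition block_step (s : R) (k : nat) (x : R) : R :=
  s / (2 * c k) * (truncate (c k) x - mu k).

Lemma measurable_block_step s k : measurable_fun setT (block_step s k).
Proof.
apply: measurable_funM => //; apply: measurable_funB => //.
exact: measurable_truncate.
Qed.

(** In a block of length [2 ^ k.+1] the variances of the scaled steps add up to at most a
    constant, because both the truncated second moment and the square of the
    level divided by [2 ^ k] are of order [k.+1 `^ (2 * b)].  The maximal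
    inequality therefore gives an exponential bound that is uniform in [k]. *)
Lemma block_maximal : exists2 A, 0 <= A & forall s k t, `|s| = 1 ->
  (P [set w | ~~ stays_below (fun i w => block_step s k (X i w)) t (2 ^ k.+1) w]
   <= (A * expR (- t))%:E)%E.
Proof.
have [V V0 HV] := truncated_second_moment (X 0%N) b b0 Moo.
exists (expR V); first exact: expR_ge0.
move=> s k t s1; have [indX idX] := hX.
have c1 : 1 <= c k := trunc_level_ge1 b k b0.
have c0 : 0 < c k by exact: lt_le_trans c1.
pose v := V / (4 * 2 ^+ k).
have v0 : 0 <= v by rewrite divr_ge0// mulr_ge0// exprn_ge0.
have EV : expR V = expR (2 * v) ^+ (2 ^ k.+1).
  rewrite -expRM_natl natrX exprS /v; congr expR.
  by field; rewrite lt0r_neq0// exprn_gt0.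
rewrite EV.
apply: exponential_maximal_inequality => //.
- exact: measurable_block_step.
- by rewrite -expR0 ler_expR mulr_ge0.
move=> i; rewrite (identically_distributed_integral X
  (fun x => expR (block_step s k x)) idX); first last.
- by move=> x; exact: expR_ge0.
- by apply: measurableT_comp => //; exact: measurable_block_step.
pose W w := s / (2 * c k) * truncate (c k) (X 0%N w).
have mt : measurable_fun setT (fun w => truncate (c k) (X 0%N w)).
  exact: (measurableT_comp (measurable_truncate (c k)) (measurable_funP (X 0%N))).
have mW : measurable_fun setT W by exact: measurable_funM.
have WE w : block_step s k (X 0%N w) = W w - s / (2 * c k) * mu k.
  by rewrite /block_step mulrBr.
under eq_integral do rewrite WE.
apply: exp_moment_le => //.
- move=> w; have c20 : 0 <= 2 * c k by rewrite mulr_ge0// ltW.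
  rewrite /W normrM normrM s1 mul1r normfV (ger0_norm c20).
  rewrite invfM -mulrA ler_piMr ?invr_ge0//.
  by rewrite mulrC ler_pdivrMr// mul1r truncate_le// ltW.
- under eq_integral do rewrite EFinM.
  rewrite integralZl//; last exact: truncated_integrable.
  by rewrite [RHS]EFinM /mu fineK// integrable_fin_num//; exact: truncated_integrable.
- have -> : (fun w => (W w ^+ 2)%:E) =
      (fun w => ((4 * c k ^+ 2)^-1 * truncate (c k) (X 0%N w) ^+ 2)%:E).
    apply/funext => w; congr EFin; rewrite /W exprMn; congr (_ * _).
    rewrite exprMn -[s ^+ 2]real_normK ?num_real// s1 expr1n mul1r exprVn.
    by rewrite exprMn; congr (_ * _)^-1; rewrite expr2; ring.
  under eq_integral do rewrite EFinM.
  rewrite ge0_integralZl_EFin ?invr_ge0 ?mulr_ge0 ?sqr_ge0//; first last.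
  + by apply/measurable_EFinP; exact: measurable_funX.
  + by move=> w _; rewrite lee_fin sqr_ge0.
  apply: (@le_trans _ _ ((4 * c k ^+ 2)^-1%:E * (V * k.+1%:R `^ (2 * b))%:E)%E).
    by rewrite lee_wpmul2l// lee_fin invr_ge0 mulr_ge0// sqr_ge0.
  rewrite -EFinM lee_fin /c /trunc_level exprMn sqr_sqrtr ?exprn_ge0//.
  rewrite -powR_sqr// /v; set p := _ `^ _; set q := 2 ^+ k.
  have p0 : 0 < p by rewrite powR_gt0.
  have q0 : 0 < q by rewrite exprn_gt0.
  by rewrite le_eqVlt; apply/orP; left; apply/eqP; field; rewrite !gt_eqF.
Qed.

End deviation.

Section deviation_almost_surely.
Context {d : measure_display} {T : measurableType d} {R : realType}
        {P : probability T R}.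

(** Eventually no summand of the block exceeds the truncation level, and by
    [block_maximal] with [t = k.+1 `^ (b' - b)] the walk of the truncated summands
    stays within [2 * trunc_level b k * t = 2 * trunc_level b' k] of its mean: the
    exceptional probabilities [A * expR (- t)] are summable however close [b] and
    [b'] are.  The mean of the truncated walk differs from [n * E X] by the same
    order. *)
Lemma deviation_bound (X : nat -> {RV P >-> R}) (b b' : R) :
  iid X -> 0 <= b -> b < b' ->
  (\int[P]_w (moment_weight b (X 0%N w))%:E < +oo)%E ->
  {ae P, forall w, exists D N, forall n, (N <= n)%N ->
    `|partial_sum X n w - n%:R * fine (\int[P]_w (X 0%N w)%:E)%E| <=
    D * growth b' n}.
Proof.
move=> hX b0 bb' Moo; have [indX idX] := hX.
have b'0 : 0 <= b' by exact/ltW/(le_lt_trans b0).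
pose c := @trunc_level R b.
have c0 k : 0 < c k by exact: lt_le_trans ltr01 (trunc_level_ge1 b k b0).
pose m := fine (\int[P]_w (X 0%N w)%:E)%E.
pose mu k := fine (\int[P]_w (truncate (c k) (X 0%N w))%:E)%E.
pose t k : R := k.+1%:R `^ (b' - b).
have ct k : c k * t k = trunc_level b' k.
  rewrite /c /t /trunc_level -mulrA; congr (_ * _).
  by rewrite -powRD ?pnatr_eq0 ?implybT// addrC subrK.
have [C C0 HC] := truncated_mean (X 0%N) b b0 Moo.
have [A A0 HA] := block_maximal X b hX b0 Moo.
have [K K0 HK] := trunc_level_le_growth b' b'0.
pose E1 k := \big[setU/set0]_(i < 2 ^ k.+1) [set w | c k < `|X i.+1 w|].
have mE0 k i : measurable [set w | c k < `|X i w|].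
  exact: (measurable_preimage_RV (X i) _ (measurable_norm_gt (c k))).
have ae1 : {ae P, forall w, exists k0, forall k, (k0 <= k)%N -> ~ E1 k w}.
  apply: borel_cantelli_eventually.
    by move=> k; apply: bigsetU_measurable.
  apply: le_lt_trans (tail_series_lty (X 0%N) b b0 Moo).
  apply: lee_nneseries => // k _.
  apply: (le_trans (@Boole_inequality _ R T P
    (fun i => [set w | c k < `|X i.+1 w|]) (2 ^ k.+1) _)).
    by move=> i _; exact: mE0.
  have h i : P [set w | c k < `|X i w|] = P [set w | c k < `|X 0%N w|].
    exact: (idX i 0%N [set x | c k < `|x|] (measurable_norm_gt (c k))).
  rewrite (eq_bigr (fun=> P [set w | c k < `|X 0%N w|])); last by move=> i _; exact: h.
  rewrite sumr_const card_ord -[_ *+ _]/(_ *+ _)%E.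
  by rewrite -mule_natl natrX.
pose E2 s k := [set w | ~~ stays_below
  (fun i w => block_step X b s k (X i w)) (t k) (2 ^ k.+1) w].
have ae2 s : `|s| = 1 ->
    {ae P, forall w, exists k0, forall k, (k0 <= k)%N -> ~ E2 s k w}.
  move=> s1; apply: borel_cantelli_eventually.
    move=> k; have := @measurable_stays_below _ _ T
      (fun i w => block_step X b s k (X i w)) (t k) (2 ^ k.+1).
    move=> /(_ _ measurableT [set false] I); rewrite setTI.
    have my i : (0 < i <= 2 ^ k.+1)%N ->
        measurable_fun setT (fun w => block_step X b s k (X i w)).
      by move=> _; apply: measurableT_comp => //; exact: measurable_block_step.
    move=> /(_ my); congr (measurable _).
    by apply/seteqP; split => w; rewrite /E2 /=; case: stays_below.
  apply: (@le_lt_trans _ _ (\sum_(k <oo) (A%:E * (expR (- t k))%:E))%E).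
    apply: lee_nneseries => k _ //.
    by rewrite -EFinM; exact: HA.
  rewrite nneseriesZl//.
  rewrite lte_mul_pinfty ?lee_fin//.
  by apply: stretched_exp_series_lty; rewrite subr_gt0.
have s1 : `|1| = 1 :> R by rewrite normr1.
have s2 : `|-1| = 1 :> R by rewrite normrN1.
move: (ae2 1 s1) (ae2 (-1) s2); apply: filterS3 ae1 => w.
move=> [k1 H1] [k2 H2] [k3 H3].
pose k0 := maxn k1 (maxn k2 k3).
exists ((2 + 2 * C) * K); exists (2 ^ k0)%N => n n0.
have n1 : (0 < n)%N by apply: leq_trans n0; rewrite expn_gt0.
(* the dyadic block of [n] *)
pose k := trunc_log 2 n.
have /andP[kn nk] : (2 ^ k <= n < 2 ^ k.+1)%N by exact: trunc_log_bounds.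
have k0k : (k0 <= k)%N by rewrite trunc_log_max.
have {}H1 : ~ E1 k w by apply: H1; apply: leq_trans k0k; rewrite leq_max leqnn.
have {}H2 : ~ E2 1 k w.
  by apply: H2; apply: leq_trans k0k; rewrite !leq_max leqnn orbT.
have {}H3 : ~ E2 (-1) k w.
  by apply: H3; apply: leq_trans k0k; rewrite !leq_max leqnn !orbT.
have Xc i : (0 < i < n.+1)%N -> truncate (c k) (X i w) = X i w.
  move=> /andP[i0 iin]; rewrite /truncate ifT// leNgt; apply/negP => cX.
  apply: H1; rewrite /E1 -(bigcup_mkord _ (fun i => [set w | c k < `|X i.+1 w|])).
  by exists i.-1; rewrite /= prednK// (leq_trans (_ : i <= n)%N (ltnW nk)).
have sumE s : \sum_(1 <= i < n.+1) block_step X b s k (X i w) =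
    s / (2 * c k) * (partial_sum X n w - n%:R * mu k).
  rewrite /block_step -mulr_sumr sumrB sumr_const_nat subn1/=.
  congr (_ * (_ - _)); last by rewrite mulr_natl.
  by rewrite /partial_sum; apply: eq_big_nat => i /Xc.
have bd s : ~ E2 s k w ->
    s * (partial_sum X n w - n%:R * mu k) <= 2 * (c k * t k).
  move=> /negP; rewrite negbK => H.
  have : \sum_(1 <= i < n.+1) block_step X b s k (X i w) <= t k.
    rewrite leNgt; apply/negP => /ltW tk.
    move: H; apply/negP; apply: (not_stays_below _ _ _ n) tk.
    by rewrite n1 ltnW.
  rewrite sumE mulrAC ler_pdivrMr ?mulr_gt0//.
  by rewrite mulrC mulrA [t k * _]mulrC.
have near_mu : `|partial_sum X n w - n%:R * mu k| <= 2 * trunc_level b' k.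
  rewrite ler_norml -ct; apply/andP; split; last by have := bd _ H2; rewrite mul1r.
  by rewrite lerNl; have := bd _ H3; rewrite mulN1r.
have mean : `|n%:R * mu k - n%:R * m| <= 2 * C * trunc_level b' k.
  rewrite -mulrBr normrM ger0_norm//.
  have p2 : 0 < 2 ^+ k :> R by rewrite exprn_gt0.
  apply: (@le_trans _ _ (2 ^+ k.+1 * (C * (k.+1%:R `^ b / Num.sqrt (2 ^+ k))))).
    apply: ler_pM => //; last exact: HC.
    by rewrite -natrX ler_nat ltnW.
  rewrite exprS /trunc_level.
  have := sqr_sqrtr (ltW p2); have : 0 < Num.sqrt (2 ^+ k) :> R by rewrite sqrtr_gt0.
  set s := Num.sqrt _ => s0 <-.
  rewrite (_ : 2 * s ^+ 2 * _ = 2 * C * (s * k.+1%:R `^ b)); last by field; rewrite gt_eqF.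
  rewrite ler_wpM2l ?mulr_ge0// ler_wpM2l ?(ltW s0)//.
  by rewrite ler_powR ?ler1n// ltW.
apply: (@le_trans _ _ ((2 + 2 * C) * trunc_level b' k)).
  apply: (le_trans (ler_distD (n%:R * mu k) _ _)).
  by rewrite mulrDl lerD.
by rewrite -mulrA ler_wpM2l ?HK// addr_ge0// mulr_ge0.
Qed.

End deviation_almost_surely.

(** * The limit superior of the normalized sums *)

Section limsup.
Context {R : realType}.
Implicit Types (u : (\bar R)^nat) (l : \bar R).

Lemma limn_esup_le u l N : (forall n, (N <= n)%N -> (u n <= l)%E) ->
  (limn_esup u <= l)%E.
Proof.
move=> ul; rewrite /limn_esup limf_esupE.
apply: (@le_trans _ _ (ereal_sup (u @` [set n | (N <= n)%N]))).
  by apply: ereal_inf_lbound; exists [set n | (N <= n)%N] => //; exists N.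
by apply: ge_ereal_sup => _ [n /= Nn <-]; exact: ul.
Qed.

Lemma limn_esup_ge u l :
  (forall m, exists2 n, (m <= n)%N & (l <= u n)%E) -> (l <= limn_esup u)%E.
Proof.
move=> ul; rewrite /limn_esup limf_esupE.
apply: le_ereal_inf_tmp => _ [V [m _ mV] <-].
have [n mn /le_trans] := ul m; apply.
by apply: ereal_sup_ubound; exists n => //; exact: mV.
Qed.

Lemma limn_esup_lt u l : (limn_esup u < l)%E ->
  exists N, forall n, (N <= n)%N -> (u n <= l)%E.
Proof.
rewrite /limn_esup limf_esupE => /ereal_inf_lt[_ [V [N _ NV] <-]] Vl.
exists N => n Nn; apply: le_trans (ltW Vl).
by apply: ereal_sup_ubound; exists n => //; exact: NV.
Qed.

(** Raising to the power [ln (ln n)], positive for [n] large, turns [expR b] into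
    [ln n `^ b]. *)
Lemma normalized_le_expR : exists N, forall n, (N <= n)%N -> forall s b : R,
  (`|s / Num.sqrt n%:R| `^ (ln (ln n%:R))^-1 <= expR b) = (`|s| <= growth b n).
Proof.
have [N HN] := exists_nat_gt (expR (expR 1) : R); exists N => n Nn s b.
have ne : expR (expR 1) < n%:R :> R by exact: HN.
have n0 : 0 < n%:R :> R by exact: lt_trans (expR_gt0 _) ne.
have ln_e : expR 1 < ln n%:R :> R.
  by rewrite -[ltLHS](@expRK R) ltr_ln ?posrE ?expR_gt0.
have l1 : 1 < ln (ln n%:R : R).
  by rewrite -[ltLHS](@expRK R) ltr_ln ?posrE ?expR_gt0// (lt_trans (expR_gt0 1)).
set l := ln (ln _) in l1 *; have l0 : 0 < l by exact: lt_trans l1.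
have lnn0 : 0 < ln (n%:R : R) by exact: lt_trans (expR_gt0 1) ln_e.
have e1 : 1 <= expR 1 :> R by rewrite -expR0 ler_expR.
have LE : logplus n%:R = ln n%:R :> R.
  apply: logplus_ln; apply/ltW; apply: le_lt_trans ne.
  by rewrite ler_expR.
have gE : growth b n = Num.sqrt n%:R * expR (b * l).
  have lK : expR l = ln n%:R by rewrite /l lnK ?posrE.
  by rewrite /growth LE -lK -expRM [l * b]mulrC.
have s0 : 0 < Num.sqrt n%:R :> R by rewrite sqrtr_gt0.
rewrite gE normrM normfV (gtr0_norm s0) [Num.sqrt _ * _]mulrC -ler_pdivrMr//.
set y := `|s| / _; have y0 : 0 <= y by rewrite divr_ge0// ltW.
apply/idP/idP => h.
  have -> : y = (y `^ l^-1) `^ l by rewrite -powRrM mulVf ?gt_eqF// powRr1.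
  by rewrite expRM; apply: ge0_ler_powR; rewrite ?nnegrE ?powR_ge0 ?expR_ge0// ltW.
have -> : expR b = expR (b * l) `^ l^-1 by rewrite -expRM mulfK// gt_eqF.
by apply: ge0_ler_powR; rewrite ?nnegrE ?invr_ge0 ?expR_ge0// ltW.
Qed.

End limsup.

Section limsup_bounds.
Context {d : measure_display} {T : measurableType d} {R : realType}
        {P : probability T R}.

Lemma ae_contradiction : ~ {ae P, forall w : T, False}.
Proof.
move=> [A [mA PA0 sA]].
have AT : A = setT by rewrite -subTset => w _; apply: sA => /=; exact.
by have := probability_setT P; rewrite -AT PA0 => /eqP; rewrite eqe eq_sym oner_eq0.
Qed.

(** By [moment_weight_le_linear] the number of [n] with [C * growth b n < `|Y w|]
    is, up to additive and multiplicative constants, at least the weight of [Y w]. *)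
Lemma moment_lty_of_tails (Y : {RV P >-> R}) (b C : R) : 0 < b -> 0 < C ->
  (\sum_(n <oo) P (Y @^-1` [set x | (C * growth b n < `|x|)%R]) < +oo)%E ->
  (\int[P]_w (moment_weight b (Y w))%:E < +oo)%E.
Proof.
move=> b0 C0 Soo; have [K K0 HK] := moment_weight_le_linear b C b0 C0.
pose A n := Y @^-1` [set x | C * growth b n < `|x|].
have mA n : measurable (A n).
  exact: (measurable_preimage_RV Y _ (measurable_norm_gt _)).
have mM : measurable_fun setT (fun w => moment_weight b (Y w)).
  by apply: (measurableT_comp (measurable_moment_weight b)).
have mS : measurable_fun setT (fun w => \sum_(n <oo) (\1_(A n) w : R)%:E)%E.
  apply: ge0_emeasurable_sum => [n w _ _|n _]; first by rewrite lee_fin.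
  by apply/measurable_EFinP; exact: measurable_indic.
have S0 w : (0 <= \sum_(n <oo) (\1_(A n) w : R)%:E :> \bar R)%E.
  by apply: nneseries_ge0 => n _ _; rewrite lee_fin.
apply: (@le_lt_trans _ _
  (\int[P]_w (K%:E + K%:E * (\sum_(n <oo) (\1_(A n) w : R)%:E)))%E).
  apply: ge0_le_integral => //.
  - by move=> w _; rewrite lee_fin moment_weight_ge0.
  - exact/measurable_EFinP.
  - by apply: emeasurable_funD => //; exact: measurable_funeM.
  - move=> w _; pose y := moment_weight b (Y w) / K.
    have y0 : 0 <= y by rewrite divr_ge0 ?moment_weight_ge0// ltW.
    have /andP[tn nt] := truncn_itv y0; set N := Num.truncn y in tn nt.
    apply: (@le_trans _ _ (K%:E + K%:E * N%:R%:E)%E).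
      rewrite -EFinM -EFinD lee_fin -[X in X + _]mulr1 -mulrDr.
      by rewrite mulrC -ler_pdivrMr// addrC natr1 ltW.
    rewrite leeD2l// lee_wpmul2l ?lee_fin ?(ltW K0)//.
    apply: (@le_trans _ _ (\sum_(0 <= n < N) (\1_(A n) w : R)%:E)%E); last first.
      by apply: nneseries_lim_ge => n _ _; rewrite lee_fin.
    rewrite sumEFin lee_fin -[N in leLHS]subn0 -sumr_const_nat.
    rewrite big_nat [leRHS]big_nat; apply: ler_sum => n /andP[_ nN].
    rewrite indicE mem_set// /A /=.
    rewrite ltNge; apply/negP => /HK; apply/negP; rewrite -ltNge.
    rewrite mulrC -ltr_pdivlMr//; apply: lt_le_trans tn.
    by rewrite ltr_nat.
rewrite ge0_integralD//; first last.
- exact: measurable_funeM.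
- by move=> w _; rewrite mule_ge0// lee_fin ltW.
- by move=> w _; rewrite lee_fin ltW.
rewrite integral_cst// ge0_integralZl//; last by rewrite lee_fin ltW.
rewrite integral_nneseries//; first last.
- by move=> n; apply/measurable_EFinP; exact: measurable_indic.
apply: lte_add_pinfty.
  rewrite lte_mul_pinfty ?lee_fin ?(ltW K0)//.
  by rewrite -ge0_fin_numE ?measure_ge0 ?fin_num_measure.
rewrite lte_mul_pinfty ?lee_fin ?(ltW K0)//.
by under eq_eseriesr do rewrite integral_indic// setIT.
Qed.

Lemma expectation_moment_weight (Y : {RV P >-> R}) (b : R) :
  ('E_P[fun w => ((Y w) ^+ 2 / (logplus `|Y w|) `^ (2 * b))%R] =
   \int[P]_w (moment_weight b (Y w))%:E)%E.
Proof. by rewrite unlock. Qed.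

Variable X : nat -> {RV P >-> R}.
Hypothesis hX : iid X.

Lemma partial_sumS n w :
  partial_sum X n.+1 w = partial_sum X n w + X n.+1 w.
Proof. by rewrite /partial_sum big_nat_recr. Qed.

Lemma large_summands_io (b C : R) : 0 < b -> 0 < C ->
  (\int[P]_w (moment_weight b (X 0%N w))%:E = +oo)%E ->
  {ae P, forall w m, exists2 n, (m <= n)%N & C * growth b n < `|X n w|}.
Proof.
move=> b0 C0 Moo; have [indX idX] := hX.
apply: (borel_cantelli_indep X (fun n => [set x | C * growth b n < `|x|])) => //.
  by move=> n; exact: measurable_norm_gt.
apply/eqP; rewrite -leye_eq leNgt; apply/negP => Soo.
suff : (\int[P]_w (moment_weight b (X 0%N w))%:E < +oo)%E by rewrite Moo.
apply: (moment_lty_of_tails (X 0%N) b C) => //.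
apply: le_lt_trans Soo; apply: lee_nneseries => // n _.
set B := [set x | _].
have h : P (X 0%N @^-1` B) = P (X n @^-1` B) := idX 0%N n B (measurable_norm_gt _).
by rewrite h.
Qed.

(** A summand larger than [2 * growth b n] is the difference of two consecutive
    partial sums, one of which is then larger than [growth b n]. *)
Lemma limsup_ge (b : R) : 0 < b ->
  (\int[P]_w (moment_weight b (X 0%N w))%:E = +oo)%E ->
  {ae P, forall w,
    ((expR b)%:E <= limn_esup (fun n => (normalized_sum X n w)%:E))%E}.
Proof.
move=> b0 Moo; have [N HN] := @normalized_le_expR R.
apply: filterS (large_summands_io b 2 b0 (ltr0n _ 2) Moo) => w io.
apply: limn_esup_ge => m.
have [[//|n] mn Xn] := io (maxn N m).+1.
have gt k : (maxn N m <= k)%N -> growth b k < `|partial_sum X k w| ->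
    exists2 n, (m <= n)%N & ((expR b)%:E <= (normalized_sum X n w)%:E)%E.
  rewrite geq_max => /andP[Nk mk] gk; exists k => //; rewrite lee_fin ltW//.
  by rewrite ltNge /normalized_sum HN// -ltNge.
have [h|h] := ltP (growth b n.+1) `|partial_sum X n.+1 w|.
  by apply: (gt n.+1) => //; exact: ltnW.
apply: (gt n) => //.
apply: le_lt_trans (growth_le b n n.+1 (ltW b0) (leqnSn n)) _.
rewrite ltNge; apply/negP => h'; move: Xn; apply/negP; rewrite -leNgt.
have -> : X n.+1 w = partial_sum X n.+1 w - partial_sum X n w.
  by rewrite partial_sumS addrAC subrr add0r.
by rewrite mulr_natl mulr2n (le_trans (ler_normB _ _))// lerD.
Qed.

(** [deviation_bound] for an exponent strictly between [b] and [b'], the constant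
    being absorbed by the remaining gap. *)
Lemma limsup_le (b b' : R) : 0 <= b -> b < b' ->
  (\int[P]_w (X 0%N w)%:E = 0)%E ->
  (\int[P]_w (moment_weight b (X 0%N w))%:E < +oo)%E ->
  {ae P, forall w,
    (limn_esup (fun n => (normalized_sum X n w)%:E) <= (expR b')%:E)%E}.
Proof.
move=> b0 bb' EX Moo; have [N HN] := @normalized_le_expR R.
have bm : b < (b + b') / 2 by lra.
have mb : (b + b') / 2 < b' by lra.
apply: filterS (deviation_bound X b _ hX b0 bm Moo) => w [D [N' HD]].
have [M HM] := growth_absorb D _ _ mb.
apply: (limn_esup_le _ _ (maxn N (maxn N' M))) => n.
rewrite !geq_max => /and3P[Nn N'n Mn].
rewrite lee_fin /normalized_sum HN//.
by have := HD n N'n; rewrite EX mulr0 subr0 => /le_trans; apply; exact: HM.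
Qed.

Lemma eventually_growth_of_limsup (b b' : R) w : b < b' ->
  limn_esup (fun n => (normalized_sum X n w)%:E) = (expR b)%:E ->
  exists N, forall n, (N <= n)%N -> `|partial_sum X n w| <= growth b' n.
Proof.
move=> bb' lE; have [N HN] := @normalized_le_expR R.
have [|M HM] := limn_esup_lt (fun n => (normalized_sum X n w)%:E) (expR b')%:E.
  by rewrite lE lte_fin ltr_expR.
exists (maxn N M) => n; rewrite geq_max => /andP[Nn Mn].
by have := HM n Mn; rewrite lee_fin /normalized_sum HN.
Qed.

End limsup_bounds.

Section characterization.
Context {d : measure_display} {T : measurableType d} {R : realType}
        {P : probability T R}.
Variable X : nat -> {RV P >-> R}.
Hypothesis hX : iid X.

(** If the moment were infinite, summands beyond [2 * growth b n] would occur
    infinitely often, whereas consecutive partial sums are eventually at most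
    [growth b n]. *)
Lemma moment_lty_of_limsup (beta b : R) : 0 < beta -> beta < b ->
  {ae P, forall w,
    limn_esup (fun n => (normalized_sum X n w)%:E) = (expR beta)%:E} ->
  (\int[P]_w (moment_weight b (X 0%N w))%:E < +oo)%E.
Proof.
move=> beta0 bb H; have b0 : 0 < b by exact: lt_trans bb.
rewrite ltNge leye_eq; apply/negP => /eqP Moo.
apply: (@ae_contradiction _ _ _ P).
apply: filterS2 H (large_summands_io X hX b 2 b0 (ltr0n _ 2) Moo) => w lw io.
have [N HN] := eventually_growth_of_limsup X beta b w bb lw.
have [[//|n] Nn] := io N.+1; apply/negP; rewrite -leNgt.
have -> : X n.+1 w = partial_sum X n.+1 w - partial_sum X n w.
  by rewrite partial_sumS addrAC subrr add0r.
rewrite mulr_natl mulr2n (le_trans (ler_normB _ _))// lerD//.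
  by apply: HN; exact: ltnW.
by apply: le_trans (HN n _) (growth_le b n n.+1 (ltW b0) (leqnSn n)).
Qed.

(** The partial sums stay close to [n * E X] and are themselves [o(n)]. *)
Lemma mean_zero_of_limsup (beta : R) : 0 < beta ->
  {ae P, forall w,
    limn_esup (fun n => (normalized_sum X n w)%:E) = (expR beta)%:E} ->
  (\int[P]_w (X 0%N w)%:E = 0)%E.
Proof.
move=> beta0 H.
have b1 : beta < beta + 1 by rewrite ltrDl.
have b12 : beta + 1 < beta + 2 by rewrite ltrD2l ltr1n.
have b10 : 0 <= beta + 1 by rewrite addr_ge0// ltW.
have b20 : 0 <= beta + 2 by rewrite addr_ge0// ltW.
have M1 := moment_lty_of_limsup beta (beta + 1) beta0 b1 H.
have iX := integrable_of_moment (X 0%N) (beta + 1) b10 M1.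
rewrite -[LHS]fineK ?integrable_fin_num//; congr EFin.
apply: contrapT => m0; apply: (@ae_contradiction _ _ _ P).
apply: filterS2 H (deviation_bound X _ _ hX b10 b12 M1) => w lw [D [N HD]].
have [M HM] := eventually_growth_of_limsup X beta _ w (lt_trans b1 b12) lw.
apply: m0; apply: (growth_sublinear (beta + 2) (1 + D) _ (maxn M N)) => // n.
rewrite geq_max => /andP[Mn Nn].
rewrite -[n%:R in leLHS]ger0_norm// -normrM.
set m := fine _ in HD *.
have -> : n%:R * m = partial_sum X n w - (partial_sum X n w - n%:R * m).
  by rewrite opprB addrC subrK.
rewrite mulrDl mul1r (le_trans (ler_normB _ _))// lerD//.
  exact: HM.
exact: HD.
Qed.

Lemma moment_index_ge (b : R) (beta : R) : moment_index (X 0%N) = beta%:E ->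
  0 < b -> b < beta -> (\int[P]_w (moment_weight b (X 0%N w))%:E = +oo)%E.
Proof.
move=> idx b0 bb; apply/eqP; rewrite -leye_eq leNgt; apply/negP => Moo.
have : (moment_index (X 0%N) <= b%:E)%E.
  apply: ereal_inf_lbound; exists b => //; split => //.
  by rewrite expectation_moment_weight.
by rewrite idx lee_fin leNgt bb.
Qed.

Lemma moment_index_lt (b : R) (Y : {RV P >-> R}) : (moment_index Y < b%:E)%E ->
  exists b', [/\ 0 < b', b' < b &
    (\int[P]_w (moment_weight b' (Y w))%:E < +oo)%E].
Proof.
move=> /ereal_inf_lt[_ [b' [b'0 Mb'] <-]] b'b; exists b'; split => //.
by rewrite -expectation_moment_weight.
Qed.

(** The two bounds for the limit superior hold almost surely for each single
    exponent; the sequences [beta + 1 / (k + 1)] and [beta - 1 / (k + 1)] make them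
    simultaneous. *)
Lemma limsup_of_moment_index (beta : R) : 0 < beta ->
  (\int[P]_w (X 0%N w)%:E = 0)%E -> moment_index (X 0%N) = beta%:E ->
  {ae P, forall w,
    limn_esup (fun n => (normalized_sum X n w)%:E) = (expR beta)%:E}.
Proof.
move=> beta0 EX idx.
have up : {ae P, forall w (k : nat),
    (limn_esup (fun n => (normalized_sum X n w)%:E) <=
     (expR (beta + k.+1%:R^-1))%:E)%E}.
  apply: ae_foralln => k.
  have [|b [b0 bk Mb]] := moment_index_lt (beta + k.+1%:R^-1) (X 0%N).
    by rewrite idx lte_fin ltrDl invr_gt0.
  exact: (limsup_le X hX b _ (ltW b0) bk EX Mb).
have low : {ae P, forall w (k : nat), 0 < beta - k.+1%:R^-1 ->
    ((expR (beta - k.+1%:R^-1))%:E <=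
     limn_esup (fun n => (normalized_sum X n w)%:E))%E}.
  apply: ae_foralln => k.
  have [b0|b0] := ltP 0 (beta - k.+1%:R^-1); last by apply: nearW => w.
  have bk : beta - k.+1%:R^-1 < beta by rewrite gtrBl invr_gt0.
  apply: filterS (limsup_ge X hX _ b0 (moment_index_ge _ _ idx b0 bk)) => w h _.
  exact: h.
apply: filterS2 up low => w {}up {}low.
apply/eqP; rewrite eq_le; apply/andP; split.
  apply/lee_addgt0Pr => e e0.
  have e1 : 0 < expR beta + e by rewrite addr_gt0 ?expR_gt0.
  have : beta < ln (expR beta + e).
    by rewrite -[ltLHS]expRK ltr_ln ?posrE ?expR_gt0// ltrDl.
  move=> /ltr_add_invr[k hk]; apply: (le_trans (up k)).
  by rewrite -EFinD lee_fin -[leRHS]lnK ?posrE// ler_expR ltW.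
apply/lee_subgt0Pr => e e0.
pose y := Num.max 1 (expR beta - e).
have y1 : 1 <= y by rewrite le_max lexx.
have y0 : 0 < y by exact: lt_le_trans y1.
have yb : y < expR beta by rewrite gt_max -expR0 ltr_expR beta0 gtrBl e0.
have : ln y < beta by rewrite -[ltRHS]expRK ltr_ln ?posrE ?expR_gt0.
move=> /ltr_add_invr[k hk].
have bk : ln y < beta - k.+1%:R^-1 by rewrite ltrBrDr.
apply: le_trans (low k _); last by apply: le_lt_trans bk; exact: ln_ge0.
rewrite -EFinB lee_fin (@le_trans _ _ y)//; first by rewrite le_max lexx orbT.
by rewrite -[leLHS]lnK ?posrE// ler_expR ltW.
Qed.

End characterization.

Theorem theorem2p1 (d : measure_display) (T : measurableType d) (R : realType)
    (P : probability T R) (beta : R) (hbeta : 0 < beta)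
    (X : nat -> {RV P >-> R}) (hX : iid X) :
  {ae P, forall w,
    limn_esup (fun n => (normalized_sum X n w)%:E) = (expR beta)%:E}
  <->
  (P.-integrable setT (EFin \o X 0%N) /\ ('E_P[X 0%N] = 0)%E) /\
  moment_index (X 0%N) = beta%:E.
Proof.
have EE : ('E_P[X 0%N] = \int[P]_w (X 0%N w)%:E)%E by rewrite unlock.
rewrite EE; split => [H|[[_ EX] idx]]; last exact: limsup_of_moment_index.
have EX := mean_zero_of_limsup X hX beta hbeta H.
have Mb b (bb : beta < b) := moment_lty_of_limsup X hX beta b hbeta bb H.
have bp e : 0 < e -> beta < beta + e by move=> e0; rewrite ltrDl.
split; first split => //.
  apply: (integrable_of_moment (X 0%N) (beta + 1)); first by rewrite addr_ge0// ltW.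
  exact/Mb/bp.
apply/eqP; rewrite eq_le; apply/andP; split.
  apply/lee_addgt0Pr => e e0; apply: ereal_inf_lbound; exists (beta + e) => //.
  split; first by rewrite addr_gt0.
  by rewrite expectation_moment_weight; exact/Mb/bp.
rewrite leNgt; apply/negP => /moment_index_lt[b [b0 bb Mbb]].
have bm : b < (b + beta) / 2 by lra.
have mb : (b + beta) / 2 < beta by lra.
apply: (@ae_contradiction _ _ _ P).
apply: filterS2 H (limsup_le X hX b _ (ltW b0) bm EX Mbb) => w ->.
by rewrite lee_fin ler_expR leNgt mb.
Qed.
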